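(* Let $\lambda\neq0$. For all dimensions $n>1$, up to periodic null modes and translation of the time variable, the hermitian quantum-symmetric elements $g\in\Omega^1\otimes_A\Omega^1$ with standard angular part and that commute with functions of $r,t$ are of the form $$g=\sum_i\omega_i\otimes\omega_i+a\,\mathrm dr\otimes \mathrm dr+b\big(v^*\otimes v+\lambda(\mathrm dr\otimes v-v^*\otimes \mathrm dr)\big)$$ for real parameters $a,b$, where $v=r\,\mathrm dt-t\,\mathrm dr$.
   Context: $\lambda$ is an imaginary parameter. $A$ is the algebra with generators $x_1,\dots,x_{n-1},t$ and relations $[x_i,x_j]=0$, $[x_i,t]=\lambda x_i$. Its elements are thought of as normal-ordered functions $f(x,t)$, with $t$ to the right (the class of functions is not specified further), and $r$ with $r^2=\sum_i x_i^2$ is adjoined, so that $[r,t]=\lambda r$ and $[x_i/r,t]=0$. $\Omega^1$ is the $A$-bimodule of 1-forms, with basis $\mathrm dx_i,\mathrm dt$ over $A$ and relations $[\mathrm dx_i,x_j]=0$, $[\mathrm dx_i,t]=0$, $[x_i,\mathrm dt]=\lambda\,\mathrm dx_i$, $[t,\mathrm dt]=\lambda\,\mathrm dt$. The angular 1-forms are $\omega_i=\sum_j(\delta_{ij}-x_ix_j/r^2)\,\mathrm dx_j$. They satisfy $\sum_i x_i\omega_i=0$, and one has $$[\omega_i,t]=[\omega_i,r]=[\mathrm dr,t]=[\mathrm dr,r]=0,\quad [r,\mathrm dt]=\lambda\,\mathrm dr,\quad [t,\mathrm dt]=\lambda\,\mathrm dt.$$ Standard angular part means that the angular part of $g$ is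 fixed to be $\sum_i\omega_i\otimes\omega_i$, the remainder being built from functions of $r,t$ and the 1-forms $\mathrm dr,\mathrm dt$. (For $n=2$ the $\omega_i$ term is dropped and $r$ is regarded as the spatial variable.) Periodic null modes are nonconstant functions $h(t)$ with $h(t-\lambda)=h(t)$, such as $e^{2\pi\imath mt/\lambda}$ with $m$ a nonzero integer. ''Up to periodic null modes'' means that these are excluded from the coefficients of $g$. Translation of the time variable means replacing $t$ by $t+\beta$ with $\beta$ a real constant, which preserves all the relations. The $*$-operation is the conjugate-linear, product-reversing involution on $A$ with $x_i,t,r$ self-adjoint, extended to forms so as to commute with $\mathrm d$; thus $v^*=(\mathrm dt)r-(\mathrm dr)t$. Hermitian means that $g$ is invariant under the flip of tensor factors combined with $*$ on each factor. Quantum-symmetric means $\wedge(g)=0$, where $\omega_i,\mathrm dr,\mathrm dt$ mutually anticommute as classically.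
   Formalization: The claim omits a case: for real a and c≠0 the elements ∑ω_i⊗ω_i + a dr⊗dr + c(dr⊗v + v*⊗dr) satisfy all the conditions but no time translation brings them to the stated form; the formal theorem lists them as a second family and proves an equivalence. *)

(* Defs.v *)
From HB Require Import structures.
From mathcomp Require Import all_boot all_order all_algebra.
From mathcomp Require Import all_classical all_reals all_analysis.
From mathcomp Require Import complex.

Set Implicit Arguments.
Unset Strict Implicit.
Unset Printing Implicit Defensive.

Import Order.TTheory GRing.Theory Num.Theory.
Import numFieldNormedType.Exports.

Local Open Scope ring_scope.
Local Open Scope complex_scope.

Section SpaceDomain.
Variables (R : realType) (n : nat).
Implicit Type x : 'rV[R]_n.-1.

Definition space_radius x : R := Num.sqrt (\sum_i x 0 i ^+ 2).

(* Spatial points at which r and 1/r make sense.  For n = 2 the half-line is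
   taken, so that r is the spatial variable x_1 itself; then
   1 - x_1 x_1 / r^2 = 0 and the angular form vanishes. *)
Definition spatial x : Prop :=
  x != 0 /\ (n = 2%N -> forall i, 0 < x 0 i).

End SpaceDomain.

(* The class of functions f(x,t) is left open: A is any C-algebra whose elements
   are determined by a normal-ordered symbol (t on the right), a function of
   spatial x and of complex t, complex because lam is imaginary and t - lam has
   to be an admissible argument.

   fa_crossX, fa_crossr and fa_crosst are the forms which [x_i, t] = lam x_i,
   and hence [r, t] = lam r, take on normal-ordered functions:
     f(x,t) x_i = x_i f(x,t-lam),   f(x,t) r = r f(x,t-lam),
     t f(x,t) = f(x,t) t - lam sum_i x_i (d_i f)(x,t).
   fa_shift and fa_pd are the operations by which
     dt f = (fa_shift f) dt - lam sum_i (fa_pd i f) dx_i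
   in Omega^1; fa_shiftM and fa_pdM say that this is a right action. *)
Record function_algebra (R : realType) (n : nat) (lam : R[i])
    (A : algType R[i]) := FunctionAlgebra {
  fa_symb : A -> 'rV[R]_n.-1 -> R[i] -> R[i];
  fa_inj : forall f g : A,
    (forall x t, spatial x -> fa_symb f x t = fa_symb g x t) -> f = g;
  fa_lin : forall (c : R[i]) (f g : A) x t, spatial x ->
    fa_symb (c *: f + g) x t = c * fa_symb f x t + fa_symb g x t;
  fa_one : forall x t, spatial x -> fa_symb 1 x t = 1;

  fa_X : 'I_n.-1 -> A;
  fa_t : A;
  fa_r : A;
  fa_rV : A;
  fa_XE : forall i x t, spatial x -> fa_symb (fa_X i) x t = (x 0 i)%:C;
  fa_tE : forall x t, spatial x -> fa_symb fa_t x t = t;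
  fa_rE : forall x t, spatial x -> fa_symb fa_r x t = (space_radius x)%:C;
  fa_rVE : forall x t, spatial x -> fa_symb fa_rV x t = (space_radius x)^-1%:C;

  fa_normall : forall f g : A,
    (forall x s t, spatial x -> fa_symb f x s = fa_symb f x t) ->
    forall x t, spatial x -> fa_symb (f * g) x t = fa_symb f x t * fa_symb g x t;
  fa_normalr : forall f g : A,
    (forall x y t, spatial x -> spatial y -> fa_symb g x t = fa_symb g y t) ->
    forall x t, spatial x -> fa_symb (f * g) x t = fa_symb f x t * fa_symb g x t;

  fa_shift : A -> A;
  fa_shiftE : forall f x t, spatial x ->
    fa_symb (fa_shift f) x t = fa_symb f x (t - lam);
  fa_shiftM : forall f g, fa_shift (f * g) = fa_shift f * fa_shift g;

  fa_pd : 'I_n.-1 -> A -> A;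
  fa_pdRe : forall i f x t, spatial x ->
    is_derive (0 : R) (1 : R)
      (fun s : R => complex.Re (fa_symb f (x + s *: delta_mx 0 i) t))
      (complex.Re (fa_symb (fa_pd i f) x t));
  fa_pdIm : forall i f x t, spatial x ->
    is_derive (0 : R) (1 : R)
      (fun s : R => complex.Im (fa_symb f (x + s *: delta_mx 0 i) t))
      (complex.Im (fa_symb (fa_pd i f) x t));
  fa_pdM : forall i f g,
    fa_pd i (f * g) = fa_shift f * fa_pd i g + fa_pd i f * g;

  fa_crossX : forall i f, f * fa_X i = fa_X i * fa_shift f;
  fa_crossr : forall f, f * fa_r = fa_r * fa_shift f;
  fa_crosst : forall f,
    fa_t * f = f * fa_t - lam *: \sum_i fa_X i * fa_pd i f
}.

Section Forms.
Variables (R : realType) (n : nat) (lam : R[i]) (A : algType R[i]).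
Variable F : @function_algebra R n lam A.

Local Notation X := (fa_X F).
Local Notation t := (fa_t F).
Local Notation r := (fa_r F).
Local Notation rV := (fa_rV F).
Local Notation shift := (fa_shift F).
Local Notation pd := (fa_pd F).

(* Left A-coefficients in the basis dx_i (index Some i), dt (index None). *)
Definition form1 : lmodType A := {ffun option 'I_n.-1 -> A^o}.

(* Omega^1 tensor_A Omega^1 as a free left Omega^1-module: g stands for
   sum_b (g b) (x) e_b with e_b ranging over the basis, so that g b a is the left
   coefficient of e_a (x) e_b. *)
Definition form2 : lmodType A := {ffun option 'I_n.-1 -> form1}.

Definition basis_form (a : option 'I_n.-1) : form1 := [ffun b => (b == a)%:R].

(* dx_i f = f dx_i, which contains [dx_i, x_j] = [dx_i, t] = 0, and
   dt f = f(x,t-lam) dt - lam sum_i (d_i f) dx_i, which contains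
   [x_i, dt] = lam dx_i and [t, dt] = lam dt. *)
Definition form1_mulr (eta : form1) (f : A) : form1 :=
  [ffun a => if a is Some i then eta (Some i) * f - lam *: (eta None * pd i f)
             else eta None * shift f].

Definition tensor (eta zeta : form1) : form2 :=
  [ffun b => form1_mulr eta (zeta b)].

Definition form2_mulr (g : form2) (f : A) : form2 :=
  \sum_b tensor (g b) (form1_mulr (basis_form b) f).

(* The dt-coefficient is forced by the Leibniz rule: d f = lam^-1 [f, dt]. *)
Definition ext_d (f : A) : form1 :=
  [ffun a => if a is Some i then pd i f else lam^-1 *: (f - shift f)].

Definition dt : form1 := ext_d t.
Definition dr : form1 := ext_d r.
Definition dX (i : 'I_n.-1) : form1 := ext_d (X i).

Definition omega (i : 'I_n.-1) : form1 :=
  \sum_j ((i == j)%:R - X i * X j * rV ^+ 2 : A) *: dX j.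

Definition angular : form2 := \sum_i tensor (omega i) (omega i).

(* Coefficients of wedge_coef g on e_a /\ e_b, the dx_i and dt anticommuting.  The
   omega_i, dr have coefficients depending on x only in terms of the dx_j, so
   omega_i /\ omega_j, omega_i /\ dr are antisymmetric, dr /\ dr = 0, and
   dr /\ dt = - dt /\ dr. *)
Definition wedge_coef (g : form2) : {ffun option 'I_n.-1 * option 'I_n.-1 -> A} :=
  [ffun ab => g ab.2 ab.1 - g ab.1 ab.2].

Definition quantum_symmetric (g : form2) : Prop := wedge_coef g = 0.

Definition fun_of_rt (f : A) : Prop := forall x y s,
  spatial x -> spatial y -> space_radius x = space_radius y ->
  fa_symb F f x s = fa_symb F f y s.

Definition fun_of_t (f : A) : Prop := forall x y s,
  spatial x -> spatial y -> fa_symb F f x s = fa_symb F f y s.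

Definition commutes_with_rt (g : form2) : Prop :=
  forall f, fun_of_rt f -> f *: g = form2_mulr g f.

Definition periodic_null_mode (h : A) : Prop :=
  [/\ fun_of_t h,
      forall x s, spatial x -> fa_symb F h x (s - lam) = fa_symb F h x s
    & ~ exists c : R[i], h = c%:A].

(* A space of functions of r, t, free of periodic null modes, from which the
   coefficients of g are taken. *)
Record null_mode_free (K : A -> Prop) : Prop := NullModeFree {
  nmf_rt : forall f, K f -> fun_of_rt f;
  nmf_1 : K 1;
  nmf_lin : forall (c : R[i]) f g, K f -> K g -> K (c *: f + g);
  nmf_r : forall f, K f -> K (r * f);
  nmf_rV : forall f, K f -> K (rV * f);
  nmf_t : forall f, K f -> K (f * t);
  nmf_null : forall h, K h -> ~ periodic_null_mode h
}.

Definition standard_angular_part (K : A -> Prop) (g : form2) : Prop :=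
  exists prr prt ptr ptt : A,
    [/\ K prr, K prt, K ptr, K ptt
      & g = angular + prr *: tensor dr dr + prt *: tensor dr dt
            + ptr *: tensor dt dr + ptt *: tensor dt dt].

(* g' is g with t replaced by t + beta. *)
Definition time_translate (beta : R) (g g' : form2) : Prop :=
  forall a b x s, spatial x ->
    fa_symb F (g' b a) x s = fa_symb F (g b a) x (s + beta%:C).

(* (sum_a f_a e_a)^* = sum_a e_a f_a^*, the basis forms being self-adjoint. *)
Definition form1_star (star : A -> A) (eta : form1) : form1 :=
  \sum_a form1_mulr (basis_form a) (star (eta a)).

Record star_operation (star : A -> A) : Prop := StarOperation {
  star_semilin : forall (c : R[i]) f g,
    star (c *: f + g) = (c^*)%C *: star f + star g;
  star_M : forall f g, star (f * g) = star g * star f;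
  star_K : forall f, star (star f) = f;
  star_X : forall i, star (X i) = X i;
  star_t : star t = t;
  star_r : star r = r;
  star_d : forall f, form1_star star (ext_d f) = ext_d (star f)
}.

Variable star : A -> A.

(* eta (x) zeta |-> zeta^* (x) eta^*. *)
Definition flip_star (g : form2) : form2 :=
  \sum_b tensor (basis_form b) (form1_star star (g b)).

Definition flip_hermitian (g : form2) : Prop := flip_star g = g.

Definition v : form1 := r *: dt - t *: dr.
Definition vstar : form1 := form1_star star v.

Definition real_const (a : R) : A := (a%:C)%:A.

Definition std_metric (a b : R) : form2 :=
  angular + real_const a *: tensor dr dr
  + real_const b *: (tensor vstar v
      + (lam%:A : A) *: (tensor dr v - tensor vstar dr)).

(* The metrics with b = 0 that a translation of t does not bring to the form
   std_metric a b: translation by beta only changes a. *)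
Definition exceptional_metric (a c : R) : form2 :=
  angular + real_const a *: tensor dr dr
  + real_const c *: (tensor dr v + tensor vstar dr).

End Forms.

(* Main.v *)
Require Import Defs.
From mathcomp Require Import all_boot all_order all_algebra.
From mathcomp Require Import all_classical all_reals all_analysis.
From mathcomp Require Import complex ring.

(* The forms dr and v = r dt - t dr commute with every function of r and t: for
   dr because x_i / r is central, for v by the chain rule for radial functions.
   Writing the (r, t)-part of g as
     a dr (x) dr + b dr (x) v + c v (x) dr + d v (x) v,
   commutation of g with r and t therefore says that a, b, c, d commute with r and
   t.  Commuting with t means killed by the Euler field sum_i x_i d_i, so such a
   function depends on t alone; commuting with r means invariant under
   t |-> t - lam, so it is constant as there are no periodic null modes.
   For constants, quantum symmetry is b = c + lam d, and since v^* = v - lam dr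
   hermiticity leaves the three real parameters of [family_metric].  Translating t
   by beta shifts b by -beta d, so b can be removed unless d = 0. *)

Set Implicit Arguments.
Unset Strict Implicit.
Unset Printing Implicit Defensive.

Import Order.TTheory GRing.Theory Num.Theory.
Import numFieldNormedType.Exports.

Local Open Scope ring_scope.
Local Open Scope complex_scope.

(** * Symbols and partial derivatives *)

Section FunctionAlgebra.
Variables (R : realType) (n : nat) (lam : R[i]) (A : algType R[i]).
Variable F : @function_algebra R n lam A.

Local Notation X := (fa_X F).
Local Notation t := (fa_t F).
Local Notation r := (fa_r F).
Local Notation rV := (fa_rV F).
Local Notation shift := (fa_shift F).
Local Notation pd := (fa_pd F).
Local Notation symb := (fa_symb F).

Implicit Types (f g : A) (x : 'rV[R]_n.-1) (s : R[i]) (c : R[i]).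

(** An element of [A] is known only through its symbol at spatial points, and symbols multiply
    pointwise only if the left factor is free of t or the right one free of x. All other products
    are handled through the crossing rules: since r is invertible, f r = r [shift f] makes the shift
    a conjugation, and the centrality of x_i / r follows.

    Membership in [K] is given for the coefficients in the basis dr, dt, while the elements to be
    proved constant are those in the basis dr, v. The change of basis is triangular, with inverse
    built from 1/r and t. The coefficient of v (x) v is therefore treated first; once it is known to
    be a constant, it enters the next ones only as a scalar, so that closure of [K] under scalars,
    1/r on the left and t on the right suffices.

    In the converse direction a translation can be undone on symbols, so a form is determined by its
    translate. *)

Lemma space_radius_gt0 x : spatial x -> 0 < space_radius x.
Proof.
case=> x_neq0 _; rewrite sqrtr_gt0 lt_def sumr_ge0 ?andbT => [|i _];
  last exact: sqr_ge0.
apply: contra x_neq0 => /eqP sum0; apply/eqP/rowP => i; rewrite mxE.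
apply/eqP; rewrite -sqrf_eq0; apply/eqP.
by have/psumr_eq0P := sum0; apply => // j _; exact: sqr_ge0.
Qed.

Lemma space_radius_sqr x : space_radius x ^+ 2 = \sum_i x 0 i ^+ 2.
Proof. by rewrite sqr_sqrtr // sumr_ge0 // => i _; rewrite sqr_ge0. Qed.

Lemma symb0 x s : spatial x -> symb 0 x s = 0.
Proof.
by move=> sx; rewrite -[X in symb X](addNr 0) -scaleN1r fa_lin // mulN1r addNr.
Qed.

Lemma symbD f g x s : spatial x -> symb (f + g) x s = symb f x s + symb g x s.
Proof. by move=> sx; rewrite -[f in LHS]scale1r fa_lin // mul1r. Qed.

Lemma symbZ c f x s : spatial x -> symb (c *: f) x s = c * symb f x s.
Proof. by move=> sx; rewrite -[X in symb X]addr0 fa_lin // symb0 // addr0. Qed.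

Lemma symbN f x s : spatial x -> symb (- f) x s = - symb f x s.
Proof. by move=> sx; rewrite -scaleN1r symbZ // mulN1r. Qed.

Lemma symb_sum (I : finType) (f : I -> A) x s : spatial x ->
  symb (\sum_i f i) x s = \sum_i symb (f i) x s.
Proof.
move=> sx; elim/big_rec2: _ => [|i y1 y2 _ <-]; first exact: symb0.
exact: symbD.
Qed.

Lemma symb_alg c x s : spatial x -> symb c%:A x s = c.
Proof. by move=> sx; rewrite symbZ // fa_one // mulr1. Qed.

Lemma symb_Xl i f x s : spatial x -> symb (X i * f) x s = (x 0 i)%:C * symb f x s.
Proof. by move=> sx; rewrite fa_normall ?fa_XE // => *; rewrite !fa_XE. Qed.

Lemma symb_rl f x s : spatial x ->
  symb (r * f) x s = (space_radius x)%:C * symb f x s.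
Proof. by move=> sx; rewrite fa_normall ?fa_rE // => *; rewrite !fa_rE. Qed.

Lemma symb_rVl f x s : spatial x ->
  symb (rV * f) x s = (space_radius x)^-1%:C * symb f x s.
Proof. by move=> sx; rewrite fa_normall ?fa_rVE // => *; rewrite !fa_rVE. Qed.

Lemma symb_tr f x s : spatial x -> symb (f * t) x s = symb f x s * s.
Proof. by move=> sx; rewrite fa_normalr ?fa_tE // => *; rewrite !fa_tE. Qed.

Lemma rVrK : rV * r = 1.
Proof.
apply: (@fa_inj _ _ _ _ F) => x s sx.
rewrite symb_rVl // fa_rE // fa_one // -rmorphM mulVf //.
exact: lt0r_neq0 (space_radius_gt0 sx).
Qed.

Lemma rrVK : r * rV = 1.
Proof.
apply: (@fa_inj _ _ _ _ F) => x s sx.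
rewrite symb_rl // fa_rVE // fa_one // -rmorphM mulfV //.
exact: lt0r_neq0 (space_radius_gt0 sx).
Qed.

Lemma shiftD f g : shift (f + g) = shift f + shift g.
Proof.
by apply: (@fa_inj _ _ _ _ F) => x s sx; rewrite fa_shiftE // !symbD // !fa_shiftE.
Qed.

Lemma shiftZ c f : shift (c *: f) = c *: shift f.
Proof.
by apply: (@fa_inj _ _ _ _ F) => x s sx; rewrite fa_shiftE // !symbZ // !fa_shiftE.
Qed.

Lemma shift0 : shift 0 = 0.
Proof. by rewrite -[X in shift X](scale0r 0) shiftZ scale0r. Qed.

Lemma shift1 : shift 1 = 1.
Proof.
by apply: (@fa_inj _ _ _ _ F) => x s sx; rewrite fa_shiftE // !fa_one.
Qed.

Lemma shift_X i : shift (X i) = X i.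
Proof.
by apply: (@fa_inj _ _ _ _ F) => x s sx; rewrite fa_shiftE // !fa_XE.
Qed.

Lemma shift_r : shift r = r.
Proof.
by apply: (@fa_inj _ _ _ _ F) => x s sx; rewrite fa_shiftE // !fa_rE.
Qed.

Lemma shift_rV : shift rV = rV.
Proof.
by apply: (@fa_inj _ _ _ _ F) => x s sx; rewrite fa_shiftE // !fa_rVE.
Qed.

Lemma shift_t : shift t = t - lam%:A.
Proof.
apply: (@fa_inj _ _ _ _ F) => x s sx.
by rewrite fa_shiftE // symbD // symbN // symb_alg // !fa_tE.
Qed.

(** The crossing rule for r turns the shift into the inner automorphism f |-> r^-1 f r; its inverse
    f |-> r f r^-1 is thereby available inside [A]. *)
Lemma shift_conj f : shift f = rV * f * r.
Proof. by rewrite -mulrA fa_crossr mulrA rVrK mul1r. Qed.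

Lemma shift_unconj f : shift (r * f * rV) = f.
Proof. by rewrite shift_conj !mulrA rVrK mul1r -mulrA rVrK mulr1. Qed.

Lemma mulr_rV f : f * rV = rV * (r * f * rV).
Proof. by rewrite !mulrA rVrK mul1r. Qed.

Lemma t_r : t * r = r * t - lam *: r.
Proof. by rewrite fa_crossr shift_t mulrBr -scalerAr mulr1. Qed.

Lemma X_rV i : X i * rV = rV * X i.
Proof. by rewrite [RHS]fa_crossX shift_rV. Qed.

(** The direction cosine x_i / r, which is central and equals the partial derivative of r. It is
    locked so that computations treat it as an atom. *)
Definition dir i : A := locked (X i * rV).

Lemma dirE i : dir i = X i * rV.
Proof. by rewrite /dir -lock. Qed.

(* [X i] moves f to its shift and [rV] moves it back. *)
Lemma dir_comm i f : dir i * f = f * dir i.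
Proof.
rewrite dirE [RHS]mulrA fa_crossX -[RHS]mulrA [shift f * rV]mulr_rV.
by rewrite -fa_crossr -(mulrA f) rrVK mulr1 mulrA.
Qed.

Lemma sum_X2 : \sum_i X i * X i = r * r.
Proof.
apply: (@fa_inj _ _ _ _ F) => x s sx; rewrite symb_sum // symb_rl // fa_rE //.
rewrite -rmorphM -expr2 space_radius_sqr rmorph_sum; apply: eq_bigr => i _.
by rewrite symb_Xl // fa_XE // -rmorphM -expr2.
Qed.

Lemma sum_dir2 : \sum_i dir i * dir i = 1.
Proof.
under eq_bigr => i _ do rewrite dirE {1}X_rV -!mulrA (mulrA (X i)).
by rewrite -mulr_sumr -mulr_suml sum_X2 !mulrA rVrK mul1r rrVK.
Qed.

(** A single direction cosine may vanish somewhere and cannot be cancelled, but the sum of their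
    squares is 1. *)
Lemma dir_inj f g : (forall i, f * dir i = g * dir i) -> f = g.
Proof.
move=> fg; rewrite -[f]mulr1 -[g]mulr1 -sum_dir2 !mulr_sumr.
by apply: eq_bigr => i _; rewrite !mulrA fg.
Qed.

Lemma ord_pred2 : n = 2%N -> forall i j : 'I_n.-1, i = j.
Proof.
move=> n2 i j; have val0 (l : 'I_n.-1) : nat_of_ord l = 0%N.
  by apply/eqP; rewrite -leqn0 -ltnS; apply: leq_trans (ltn_ord l) _; rewrite n2.
by apply/val_inj; rewrite /= !val0.
Qed.

(** Symbols are controlled only at spatial points, so the derivatives of two symbols can be compared
    only because a small step along a coordinate stays spatial. *)
Lemma near_spatial x i : spatial x ->
  \forall u \near (0 : R), spatial (x + u *: delta_mx 0 i).
Proof.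
case=> x_neq0 x_gt0.
have /existsP[k xk] : [exists k, x 0 k != 0].
  apply: contraNT x_neq0; rewrite negb_exists => /forallP x0.
  by apply/eqP/rowP => k; rewrite mxE; apply/eqP; rewrite -[_ == _]negbK.
(* A step shorter than |x_k| cannot annihilate the coordinate k; for n = 2 this is the only
   coordinate and it stays positive. *)
have : \forall u \near (0 : R), `|u| < `|x 0 k|.
  by exists `|x 0 k|; rewrite /= ?normr_gt0 // => u; rewrite /= sub0r normrN.
apply: filterS => u ux.
have ek j : `|u * (delta_mx 0 i : 'rV[R]_n.-1) 0 j| <= `|u|.
  rewrite !mxE /= normrM -[leRHS]mulr1 ler_wpM2l //.
  by case: (_ == _); rewrite ?normr1 ?normr0.
split=> [|n2 j].
  apply/eqP => /rowP/(_ k); rewrite !mxE /= => /eqP.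
  rewrite addr_eq0 => /eqP xE; move: ux; rewrite xE normrN.
  rewrite normrM -[ltLHS]mulr1 ltNge ler_wpM2l //.
  by case: (_ == _); rewrite ?normr1 ?normr0.
rewrite mxE (ord_pred2 n2 j k); have := ek k; rewrite !mxE /= => uk.
rewrite -(opprK (u * _)) subr_gt0.
apply: le_lt_trans (ler_norm _) _; rewrite normrN.
by apply: le_lt_trans uk _; rewrite -(gtr0_norm (x_gt0 n2 k)).
Qed.

Lemma is_derive_ext (h k : R -> R) (x d e : R) : is_derive x (1 : R) h d ->
  h =1 k -> d = e -> is_derive x (1 : R) k e.
Proof. by move=> + /funext <- <-. Qed.

Definition pderive (h : R -> R[i]) (d : R[i]) :=
  is_derive (0 : R) (1 : R) (fun u => complex.Re (h u)) (complex.Re d) /\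
  is_derive (0 : R) (1 : R) (fun u => complex.Im (h u)) (complex.Im d).

Lemma pderive_unique h d e : pderive h d -> pderive h e -> d = e.
Proof.
move=> [[_ dre] [_ dim]] [[_ ere] [_ eim]]; apply/eqP; rewrite eq_complex.
by rewrite -dre -dim -ere -eim !eqxx.
Qed.

Lemma near_pderive h k d : (\forall u \near (0 : R), h u = k u) ->
  pderive h d -> pderive k d.
Proof.
by move=> hk [dre dim]; split;
  [apply: near_eq_is_derive dre|apply: near_eq_is_derive dim];
  apply: filterS hk => u ->.
Qed.

Lemma pderive_linear c h k d e : pderive h d -> pderive k e ->
  pderive (fun u => c * h u + k u) (c * d + e).
Proof.
case: c d e => [a b] [d1 d2] [e1 e2] [/= hre him] [/= kre kim]; split => /=.
  apply: is_derive_ext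
    (is_deriveD (is_deriveB (is_deriveZ a hre) (is_deriveZ b him)) kre) _ _ => // u.
  rewrite -[LHS]/(a * complex.Re (h u) - b * complex.Im (h u) + complex.Re (k u)).
  by case: (h u) => ? ?; case: (k u).
apply: is_derive_ext
  (is_deriveD (is_deriveD (is_deriveZ a him) (is_deriveZ b hre)) kim) _ _ => // u.
rewrite -[LHS]/(a * complex.Im (h u) + b * complex.Re (h u) + complex.Im (k u)).
by case: (h u) => ? ?; case: (k u).
Qed.

Lemma pd_symb i f x s : spatial x ->
  pderive (fun u => symb f (x + u *: delta_mx 0 i) s) (symb (pd i f) x s).
Proof. by move=> sx; split; [exact: fa_pdRe|exact: fa_pdIm]. Qed.

Lemma pd_unique i f g :
  (forall x s, spatial x ->
    pderive (fun u => symb f (x + u *: delta_mx 0 i) s) (symb g x s)) ->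
  pd i f = g.
Proof.
move=> fg; apply: (@fa_inj _ _ _ _ F) => x s sx.
exact: pderive_unique (pd_symb _ _ _ sx) (fg _ _ sx).
Qed.

Lemma pd_linear c f g i : pd i (c *: f + g) = c *: pd i f + pd i g.
Proof.
apply: pd_unique => x s sx; rewrite fa_lin //.
apply: near_pderive (pderive_linear c (pd_symb i f s sx) (pd_symb i g s sx)).
by apply: filterS (near_spatial i sx) => u su; rewrite fa_lin.
Qed.

Lemma pd_shift f i : pd i (shift f) = shift (pd i f).
Proof.
apply: pd_unique => x s sx; rewrite fa_shiftE //.
apply: near_pderive (pd_symb i f _ sx).
by apply: filterS (near_spatial i sx) => u su; rewrite fa_shiftE.
Qed.

Lemma pd_t i : pd i t = 0.
Proof.
apply: pd_unique => x s sx; rewrite symb0 //.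
apply: (@near_pderive (fun=> s)).
  by apply: filterS (near_spatial i sx) => u su; rewrite fa_tE.
by split; exact: is_derive_cst.
Qed.

Lemma pd_X i j : pd i (X j) = (i == j)%:R.
Proof.
apply: pd_unique => x s sx.
apply: (@near_pderive (fun u => (x 0 j + u * (i == j)%:R)%:C)).
  by apply: filterS (near_spatial i sx) => u su; rewrite fa_XE // !mxE eq_sym.
have -> : symb (i == j)%:R x s = (i == j)%:R%:C.
  by case: (_ == _); rewrite ?fa_one ?symb0.
split => /=; last exact: is_derive_cst.
apply: is_derive_ext (is_deriveD (is_derive_cst (x 0 j) (0 : R) 1)
  (is_deriveZ ((i == j)%:R : R) (is_derive_id (0 : R) 1))) _ _ => [u|].
  by rewrite /= mulrC.
by rewrite add0r /GRing.scale /= mulr1.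
Qed.

Lemma pd0 i : pd i 0 = 0.
Proof. by rewrite -[X in pd i X](addNr 0) -scaleN1r pd_linear scaleN1r addNr. Qed.

Lemma pdD i f g : pd i (f + g) = pd i f + pd i g.
Proof. by rewrite -[f in LHS]scale1r pd_linear scale1r. Qed.

Lemma pdZ i c f : pd i (c *: f) = c *: pd i f.
Proof. by rewrite -[X in pd i X]addr0 pd_linear pd0 addr0. Qed.

Lemma pdN i f : pd i (- f) = - pd i f.
Proof. by rewrite -scaleN1r pdZ scaleN1r. Qed.

Lemma pd_sum (I : finType) (f : I -> A) i : pd i (\sum_j f j) = \sum_j pd i (f j).
Proof.
elim/big_rec2: _ => [|j y1 y2 _ <-]; first exact: pd0.
exact: pdD.
Qed.

Lemma pd1 i : pd i 1 = 0.
Proof.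
by have := fa_pdM F i 1 1; rewrite mulr1 shift1 mul1r mulr1 => /eqP;
  rewrite -subr_eq0 opprD addrA subrr sub0r oppr_eq0 => /eqP.
Qed.

(** The square root is not differentiated: the Leibniz rule on r r = sum_j x_j x_j gives twice r
    [pd i r] = x_i, the two terms agreeing because [pd i r] commutes with r. *)
Lemma pd_r i : pd i r = dir i.
Proof.
have r_comm : pd i r * r = r * pd i r by rewrite fa_crossr -pd_shift shift_r.
have : r * pd i r *+ 2 = X i *+ 2.
  rewrite mulr2n -{2}r_comm -{1}shift_r -fa_pdM -sum_X2 pd_sum (bigD1 i) //=.
  rewrite big1 ?addr0 => [|j ji].
    by rewrite fa_pdM pd_X eqxx shift_X mulr1 mul1r mulr2n.
  by rewrite fa_pdM pd_X eq_sym (negPf ji) mulr0 mul0r addr0.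
move=> two_r.
have rpd : r * pd i r = X i.
  apply: (@scalerI R[i] A 2%:R); first by rewrite pnatr_eq0.
  by rewrite !(scaler_nat 2).
by rewrite -[LHS]mul1r -rVrK -mulrA rpd dirE X_rV.
Qed.

Lemma pd_rV i : pd i rV = - (dir i * rV * rV).
Proof.
have := fa_pdM F i rV r; rewrite rVrK pd1 shift_rV pd_r => /esym/eqP.
rewrite addrC addr_eq0 => /eqP pd_rVr.
by rewrite -[LHS]mulr1 -rrVK mulrA pd_rVr dir_comm mulNr -mulrA dir_comm mulrA.
Qed.

(** As [dir j] is the gradient of r, this is the Hessian of r: the projection tangent to the sphere,
    divided by r. *)
Lemma pd_dir i j : pd i (dir j) = ((i == j)%:R - dir i * dir j) * rV.
Proof.
rewrite [X in pd i X]dirE fa_pdM shift_X pd_X pd_rV mulrN addrC mulrBl.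
congr (_ - _).
by rewrite -(mulrA (dir i)) (mulrA (X j)) -dir_comm -[RHS]mulrA (dirE j) -!mulrA.
Qed.

Lemma is_derive_translate (h : R -> R) (a d : R) :
  is_derive (0 : R) (1 : R) (fun u => h (a + u)) d -> is_derive a (1 : R) h d.
Proof.
move=> hd.
have sub_d : is_derive a (1 : R) (fun y : R => y - a) (1 - 0).
  exact: is_deriveB (is_derive_id _ _) (is_derive_cst _ _ _).
have {}hd : is_derive (a - a) (1 : R) (fun u => h (a + u)) d by rewrite subrr.
apply: is_derive_ext (is_derive1_comp (f := fun u => h (a + u))
  (g := fun y => y - a) hd sub_d) _ _; last by rewrite subr0 mulr1.
by move=> y; rewrite /= addrC subrK.
Qed.

(** * Radial functions restricted to a coordinate ray *)

Section Radial.
Variable i0 : 'I_n.-1.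

Definition axis (u : R) : 'rV[R]_n.-1 := u *: delta_mx 0 i0.

Lemma axisE u i : axis u 0 i = u * (i == i0)%:R.
Proof. by rewrite !mxE. Qed.

Lemma space_radius_axis u : 0 <= u -> space_radius (axis u) = u.
Proof.
move=> u_ge0; rewrite /space_radius (bigD1 i0) //= big1 => [|i i_neq].
  by rewrite axisE eqxx mulr1 addr0 sqrtr_sqr ger0_norm.
by rewrite axisE (negPf i_neq) mulr0 expr0n.
Qed.

Lemma spatial_axis u : 0 < u -> spatial (axis u).
Proof.
move=> u_gt0; split=> [|n2 i].
  apply/eqP => /rowP/(_ i0)/eqP.
  by rewrite axisE mxE eqxx mulr1 gt_eqF.
by rewrite (ord_pred2 n2 i i0) axisE eqxx mulr1.
Qed.

Lemma symb_axis f x s : fun_of_rt F f -> spatial x ->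
  symb f x s = symb f (axis (space_radius x)) s.
Proof.
move=> f_rt sx; have rx := space_radius_gt0 sx.
by apply: f_rt => //; [exact: spatial_axis|rewrite space_radius_axis // ltW].
Qed.

Lemma axis_deriveRe f (u : R) s : 0 < u ->
  is_derive u (1 : R) (fun y => complex.Re (symb f (axis y) s))
    (complex.Re (symb (pd i0 f) (axis u) s)).
Proof.
move=> u_gt0; apply: is_derive_translate.
have [dre _] := pd_symb i0 f s (spatial_axis u_gt0).
by apply: is_derive_ext dre _ _ => // y; rewrite /axis scalerDl.
Qed.

Lemma axis_deriveIm f (u : R) s : 0 < u ->
  is_derive u (1 : R) (fun y => complex.Im (symb f (axis y) s))
    (complex.Im (symb (pd i0 f) (axis u) s)).
Proof.
move=> u_gt0; apply: is_derive_translate.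
have [_ dim] := pd_symb i0 f s (spatial_axis u_gt0).
by apply: is_derive_ext dim _ _ => // y; rewrite /axis scalerDl.
Qed.

(* [axis] turns the partial derivatives of a function of r and t into one-variable
   derivatives, so no joint differentiability is needed for the chain rule. *)
Lemma pd_radial i f x s : fun_of_rt F f -> spatial x ->
  symb (pd i f) x s = (x 0 i / space_radius x)%:C *
    symb (pd i0 f) (axis (space_radius x)) s.
Proof.
move=> f_rt sx; have rx := space_radius_gt0 sx.
apply: pderive_unique (pd_symb i f s sx) _.
(* The derivative of the radius along a coordinate line is read off from the algebraic formula
   [pd_r]. *)
have dr : is_derive (0 : R) (1 : R)
    (fun u => space_radius (x + u *: delta_mx 0 i)) (x 0 i / space_radius x).
  have [] := pd_symb i r s sx; rewrite pd_r dirE symb_Xl // fa_rVE // -rmorphM /=.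
  move=> + _; apply: near_eq_is_derive.
  by apply: filterS (near_spatial i sx) => u su; rewrite fa_rE.
have x0 : space_radius (x + 0 *: delta_mx 0 i) = space_radius x.
  by rewrite scale0r addr0.
rewrite -x0 in rx.
apply: (@near_pderive
    (fun u => symb f (axis (space_radius (x + u *: delta_mx 0 i))) s)).
  by apply: filterS (near_spatial i sx) => u su; rewrite [RHS]symb_axis.
split.
  apply: is_derive_ext (is_derive1_comp
    (f := fun y => complex.Re (symb f (axis y) s))
    (g := fun u => space_radius (x + u *: delta_mx 0 i))
    (axis_deriveRe f s rx) dr) _ _ => //.
  by rewrite x0 mulrC; case: (symb _ _ _) => a b /=; rewrite mul0r subr0.
apply: is_derive_ext (is_derive1_comp
  (f := fun y => complex.Im (symb f (axis y) s))
  (g := fun u => space_radius (x + u *: delta_mx 0 i))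
  (axis_deriveIm f s rx) dr) _ _ => //.
by rewrite x0 mulrC; case: (symb _ _ _) => a b /=; rewrite mul0r addr0.
Qed.

(** With f' the derivative in r, the gradient of f is (x_i / r) f' and the Euler field gives r f',
    so both sides are x_i f'. This trades the gradient terms created by dt for Euler terms like
    those created by t. *)
Lemma r_pd_radial i f : fun_of_rt F f ->
  r * pd i f = dir i * \sum_j X j * pd j f.
Proof.
move=> f_rt; apply: (@fa_inj _ _ _ _ F) => x s sx.
rewrite symb_rl // dirE -mulrA symb_Xl // symb_rVl // symb_sum //.
under eq_bigr => j _ do rewrite symb_Xl // pd_radial // mulrA -rmorphM mulrA -expr2.
rewrite -mulr_suml -rmorph_sum -mulr_suml -space_radius_sqr pd_radial //.
rewrite !mulrA -!rmorphM; congr (_%:C * _).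
by field; rewrite lt0r_neq0 // space_radius_gt0.
Qed.

Lemma fun_of_t_central f : fun_of_rt F f -> lam != 0 -> t * f = f * t -> fun_of_t F f.
Proof.
move=> f_rt lam_neq0; rewrite fa_crosst => /eqP.
rewrite -subr_eq0 addrC addKr oppr_eq0 scaler_eq0 (negPf lam_neq0) /= => /eqP euler.
have d0 (u : R) s : 0 < u -> symb (pd i0 f) (axis u) s = 0.
  move=> u_gt0; have su := spatial_axis u_gt0.
  have := symb0 s su; rewrite -euler symb_sum // (bigD1 i0) //= big1 => [|j j_neq].
    rewrite addr0 symb_Xl // axisE eqxx mulr1 => /eqP.
    by rewrite mulf_eq0 fmorph_eq0 gt_eqF //= => /eqP.
  by rewrite symb_Xl // axisE (negPf j_neq) mulr0 mul0r.
(* Composition with exp carries the half-line to the whole line, where a vanishing derivative forces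
   a constant. *)
have cst (h dh : R -> R) (u w : R) :
    (forall y : R, 0 < y -> is_derive y (1 : R) h (dh y)) ->
    (forall y : R, 0 < y -> dh y = 0) -> 0 < u -> 0 < w -> h u = h w.
  move=> hd dh0 u_gt0 w_gt0; rewrite -(lnK u_gt0) -(lnK w_gt0).
  apply: (@is_derive_0_is_cst _ (h \o expR)) => y.
  have := is_derive1_comp (hd _ (expR_gt0 y)) (is_derive_expR y).
  by rewrite dh0 ?expR_gt0 // mul0r.
move=> x y s sx sy; rewrite (symb_axis _ f_rt sx) (symb_axis _ f_rt sy).
have [rx ry] := (space_radius_gt0 sx, space_radius_gt0 sy).
apply/eqP; rewrite eq_complex; apply/andP; split; apply/eqP.
  apply: (cst (fun y => complex.Re (symb f (axis y) s)) _ _ _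
    (fun u => @axis_deriveRe f u s) _ rx ry) => u u_gt0.
  by rewrite d0.
apply: (cst (fun y => complex.Im (symb f (axis y) s)) _ _ _
  (fun u => @axis_deriveIm f u s) _ rx ry) => u u_gt0.
by rewrite d0.
Qed.

End Radial.

End FunctionAlgebra.

(** * The bimodule of 1-forms *)

Section Bimodule.
Variables (R : realType) (n : nat) (lam : R[i]) (A : algType R[i]).
Variable F : @function_algebra R n lam A.

Local Notation Om := (form1 n A).
Local Notation shift := (fa_shift F).
Local Notation pd := (fa_pd F).
Local Notation tensor := (tensor F).
Local Notation "eta ** f" := (form1_mulr F eta f) (at level 40, left associativity).
Local Notation e := (@basis_form R n A).

Implicit Types (f h : A) (eta zeta : Om) (g : form2 n A).

Lemma form1_scaleE f eta a : (f *: eta) a = f * eta a.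
Proof. by rewrite ffunE. Qed.

Lemma form2_scaleE f g b a : (f *: g) b a = f * g b a.
Proof. by rewrite ffunE form1_scaleE. Qed.

Lemma form1_sumE (I : finType) (eta : I -> Om) a :
  (\sum_i eta i) a = \sum_i eta i a.
Proof. by elim/big_rec2: _ => [|i y1 y2 _ <-]; rewrite ffunE. Qed.

Lemma form2_sumE (I : finType) (g : I -> form2 n A) b :
  (\sum_i g i) b = \sum_i g i b.
Proof. by elim/big_rec2: _ => [|i y1 y2 _ <-]; rewrite ffunE. Qed.

Lemma basis_formE a b : e a b = (b == a)%:R.
Proof. by rewrite ffunE. Qed.

Lemma tensorE eta zeta b : tensor eta zeta b = eta ** zeta b.
Proof. by rewrite ffunE. Qed.

Lemma form1_mulr_NoneE eta f : (eta ** f) None = eta None * shift f.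
Proof. by rewrite ffunE. Qed.

Lemma form1_mulr_SomeE eta f i :
  (eta ** f) (Some i) = eta (Some i) * f - lam *: (eta None * pd i f).
Proof. by rewrite ffunE. Qed.

Lemma form1_mulrA eta f h : eta ** f ** h = eta ** (f * h).
Proof.
apply/ffunP => -[i|]; rewrite !ffunE; last by rewrite -mulrA fa_shiftM.
rewrite fa_pdM mulrDr scalerDr opprD mulrBl -(scalerAl lam) -!mulrA.
by rewrite addrA addrAC.
Qed.

Lemma form1_mulr1 eta : eta ** 1 = eta.
Proof.
apply/ffunP => -[i|]; rewrite !ffunE ?shift1 ?mulr1 //.
by rewrite pd1 mulr0 scaler0 subr0.
Qed.

Lemma form1_mulr0 eta : eta ** 0 = 0.
Proof.
apply/ffunP => -[i|]; rewrite !ffunE ?shift0 ?mulr0 //.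
by rewrite pd0 mulr0 scaler0 subr0.
Qed.

Lemma form1_mulrDl eta zeta f : (eta + zeta) ** f = eta ** f + zeta ** f.
Proof.
apply/ffunP => -[i|]; rewrite !ffunE ?mulrDl // scalerDr opprD.
exact: addrACA.
Qed.

Lemma form1_mulrDr eta f h : eta ** (f + h) = eta ** f + eta ** h.
Proof.
apply/ffunP => -[i|]; rewrite !ffunE ?shiftD ?mulrDr //.
by rewrite pdD mulrDr scalerDr opprD; exact: addrACA.
Qed.

Lemma form1_mulrZl f eta h : (f *: eta) ** h = f *: (eta ** h).
Proof.
apply/ffunP => -[i|]; rewrite !(form1_scaleE, ffunE) -mulrA //.
by rewrite mulrBr -(scalerAr lam) !mulrA.
Qed.

Lemma form1_mulrNl eta h : (- eta) ** h = - (eta ** h).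
Proof. by rewrite -scaleN1r form1_mulrZl scaleN1r. Qed.

Lemma form1_mulr_suml (I : finType) (eta : I -> Om) f :
  (\sum_i eta i) ** f = \sum_i eta i ** f.
Proof.
elim/big_rec2: _ => [|i y1 y2 _ <-]; last exact: form1_mulrDl.
by rewrite -[X in X ** f](scale0r (0 : Om)) form1_mulrZl scale0r.
Qed.

Lemma form1_mulr_alg eta (c : R[i]) : eta ** c%:A = c%:A *: eta.
Proof.
have pdc i : pd i c%:A = 0 by rewrite pdZ pd1 scaler0.
apply/ffunP => -[i|]; rewrite !(form1_scaleE, ffunE).
  by rewrite pdc mulr0 scaler0 subr0 mulr_algl mulr_algr.
by rewrite shiftZ shift1 mulr_algl mulr_algr.
Qed.

Lemma form1_basis eta : eta = \sum_a eta a *: e a.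
Proof.
apply/ffunP => b; rewrite form1_sumE (bigD1 b) //= big1 => [|a ab].
  by rewrite form1_scaleE ffunE eqxx mulr1 addr0.
by rewrite form1_scaleE ffunE eq_sym (negPf ab) mulr0.
Qed.

Lemma basis_mulr_Some i f : e (Some i) ** f = f *: e (Some i).
Proof.
apply/ffunP => -[j|]; rewrite !(form1_scaleE, ffunE) /= ?mul0r ?mulr0 //.
by rewrite scaler0 subr0; case: (_ == _); rewrite ?mul1r ?mulr1 ?mul0r ?mulr0.
Qed.

Lemma basis_mulr_None f :
  e None ** f = shift f *: e None - lam%:A *: \sum_i pd i f *: e (Some i).
Proof.
apply/ffunP => -[j|]; rewrite !(form1_sumE, form1_scaleE, ffunE) /=.
  rewrite (bigD1 j) //= big1 => [|i ij].
    by rewrite form1_scaleE ffunE eqxx mul0r !mulr1 mulr0 addr0 mul1r mulr_algl.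
  by rewrite form1_scaleE ffunE (inj_eq Some_inj) eq_sym (negPf ij) mulr0.
rewrite big1 => [|i _]; last by rewrite form1_scaleE ffunE mulr0.
by rewrite mul1r mulr1 mulr0 subr0.
Qed.

Lemma tensorDl eta1 eta2 zeta :
  tensor (eta1 + eta2) zeta = tensor eta1 zeta + tensor eta2 zeta.
Proof. by apply/ffunP => b; rewrite !ffunE form1_mulrDl. Qed.

Lemma tensorDr eta zeta1 zeta2 :
  tensor eta (zeta1 + zeta2) = tensor eta zeta1 + tensor eta zeta2.
Proof. by apply/ffunP => b; rewrite !ffunE form1_mulrDr. Qed.

Lemma tensorZl f eta zeta : tensor (f *: eta) zeta = f *: tensor eta zeta.
Proof. by apply/ffunP => b; rewrite !ffunE form1_mulrZl. Qed.

Lemma tensorZr f eta zeta : tensor eta (f *: zeta) = tensor (eta ** f) zeta.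
Proof. by apply/ffunP => b; rewrite [LHS]ffunE [RHS]ffunE form1_mulrA form1_scaleE. Qed.

Lemma tensorNl eta zeta : tensor (- eta) zeta = - tensor eta zeta.
Proof. by rewrite -scaleN1r tensorZl scaleN1r. Qed.

Lemma tensorNr eta zeta : tensor eta (- zeta) = - tensor eta zeta.
Proof.
apply/eqP; rewrite -addr_eq0 -tensorDr addNr.
by apply/eqP/ffunP => b; rewrite !ffunE form1_mulr0.
Qed.

Lemma tensor0l zeta : tensor 0 zeta = 0.
Proof. by rewrite -[X in tensor X](scale0r (0 : Om)) tensorZl scale0r. Qed.

Lemma tensor0r eta : tensor eta 0 = 0.
Proof. by apply/ffunP => b; rewrite !ffunE form1_mulr0. Qed.

Lemma tensor_suml (I : finType) (eta : I -> Om) zeta :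
  tensor (\sum_i eta i) zeta = \sum_i tensor (eta i) zeta.
Proof.
elim/big_rec2: _ => [|i y1 y2 _ <-]; [exact: tensor0l|exact: tensorDl].
Qed.

Lemma tensor_sumr (I : finType) eta (zeta : I -> Om) :
  tensor eta (\sum_i zeta i) = \sum_i tensor eta (zeta i).
Proof.
elim/big_rec2: _ => [|i y1 y2 _ <-]; [exact: tensor0r|exact: tensorDr].
Qed.

Lemma form2_mulrD (g1 g2 : form2 n A) f :
  form2_mulr F (g1 + g2) f = form2_mulr F g1 f + form2_mulr F g2 f.
Proof.
rewrite /form2_mulr -big_split; apply: eq_bigr => b _.
by rewrite ffunE tensorDl.
Qed.

Lemma form2_mulrZ h g f : form2_mulr F (h *: g) f = h *: form2_mulr F g f.
Proof.
rewrite /form2_mulr scaler_sumr; apply: eq_bigr => b _.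
by rewrite ffunE tensorZl.
Qed.

Lemma form2_mulr_sum (I : finType) (g : I -> form2 n A) f :
  form2_mulr F (\sum_i g i) f = \sum_i form2_mulr F (g i) f.
Proof.
elim/big_rec2: _ => [|i y1 y2 _ <-]; last exact: form2_mulrD.
by rewrite -[X in form2_mulr F X](scale0r (0 : form2 n A)) form2_mulrZ scale0r.
Qed.

(** [form2_mulr] is defined on the basis. Expanding [zeta] and moving its coefficients across the
    tensor sign shows that it acts on the second factor of every tensor. *)
Lemma form2_mulr_tensor eta zeta f :
  form2_mulr F (tensor eta zeta) f = tensor eta (zeta ** f).
Proof.
rewrite [in RHS](form1_basis zeta) form1_mulr_suml tensor_sumr.
apply: eq_bigr => b _; rewrite form1_mulrZl tensorZr.
by rewrite ffunE.
Qed.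

Lemma tensor_comm eta zeta f : eta ** f = f *: eta -> zeta ** f = f *: zeta ->
  form2_mulr F (tensor eta zeta) f = f *: tensor eta zeta.
Proof. by move=> etaf zetaf; rewrite form2_mulr_tensor zetaf tensorZr etaf tensorZl. Qed.

Lemma big_option (V : nmodType) (I : finType) (G : option I -> V) :
  \sum_a G a = G None + \sum_i G (Some i).
Proof.
rewrite (bigD1 None) //=; congr (_ + _).
rewrite (reindex_omap Some id) /=; last by case.
by apply: eq_bigl => i; rewrite eqxx.
Qed.

(** * The involution on forms and the hermitian flip *)

Section Star.
Variables (star : A -> A) (star_op : star_operation F star).
Local Notation r := (fa_r F).
Local Notation rV := (fa_rV F).
Local Notation "eta ^#" := (form1_star F star eta) (at level 2, format "eta ^#").

Lemma starD f h : star (f + h) = star f + star h.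
Proof. by rewrite -[f in LHS]scale1r (star_semilin star_op) rmorph1 scale1r. Qed.

Lemma star0 : star 0 = 0.
Proof. by apply: (addIr (star 0)); rewrite -starD !add0r. Qed.

Lemma starZ c f : star (c *: f) = (c^*)%C *: star f.
Proof. by rewrite -[in LHS](addr0 (c *: f)) (star_semilin star_op) star0 addr0. Qed.

Lemma starN f : star (- f) = - star f.
Proof. by apply/eqP; rewrite -addr_eq0 -starD addNr star0. Qed.

Lemma star1 : star 1 = 1.
Proof.
rewrite -[LHS]mulr1 -{2}(star_K star_op 1) -(star_M star_op) mulr1.
exact: star_K star_op 1.
Qed.

Lemma star_alg c : star c%:A = (c^*)%C%:A.
Proof. by rewrite starZ star1. Qed.

Lemma star_rV : star rV = rV.
Proof.
have := star_M star_op r rV; rewrite rrVK star1 (star_r star_op) => starV.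
by rewrite -[LHS]mulr1 -(rrVK F) mulrA -starV mul1r.
Qed.

Lemma star_dir i : star (dir F i) = dir F i.
Proof. by rewrite dirE (star_M star_op) star_rV (star_X star_op) X_rV. Qed.

Lemma star_shift f : star (shift f) = r * star f * rV.
Proof.
by rewrite shift_conj !(star_M star_op) star_rV (star_r star_op) mulrA.
Qed.

Hypotheses (lam_neq0 : lam != 0) (lam_im : complex.Re lam = 0).

Lemma conjc_lam : (lam^*)%C = - lam.
Proof.
by case: lam lam_im => a b /= ->; apply/eqP; rewrite eq_complex /= oppr0 !eqxx.
Qed.

(* [star_d] gives this after cancelling the dt-part of [ext_d f]. *)
Lemma star_pd i f : star (pd i f) = pd i (r * star f * rV).
Proof.
have := star_d star_op f => /ffunP/(_ (Some i)).
rewrite /form1_star form1_sumE big_option (bigD1 i) //= big1 => [|j ji].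
  rewrite addr0 basis_mulr_Some form1_scaleE !ffunE /= eqxx mulr1 mul0r mul1r sub0r.
  rewrite starZ starD starN star_shift fmorphV /= conjc_lam pdZ scalerA.
  rewrite invrN mulrN mulfV // scaleN1r opprK pdD pdN.
  by rewrite -addrA -[RHS]addr0 => /addrI /eqP; rewrite addrC subr_eq0 => /eqP.
by rewrite basis_mulr_Some form1_scaleE !ffunE (inj_eq Some_inj) eq_sym (negPf ji) mulr0.
Qed.

Lemma form1_starD eta zeta : (eta + zeta)^# = eta^# + zeta^#.
Proof.
rewrite /form1_star -big_split; apply: eq_bigr => a _.
by rewrite ffunE starD form1_mulrDr.
Qed.

Lemma form1_star_sum (I : finType) (eta : I -> Om) :
  (\sum_i eta i)^# = \sum_i (eta i)^#.
Proof.
elim/big_rec2: _ => [|i y1 y2 _ <-]; last exact: form1_starD.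
by rewrite /form1_star big1 // => a _; rewrite ffunE star0 form1_mulr0.
Qed.

Lemma form1_starZ f eta : (f *: eta)^# = eta^# ** star f.
Proof.
rewrite /form1_star form1_mulr_suml; apply: eq_bigr => a _.
by rewrite form1_scaleE (star_M star_op) form1_mulrA.
Qed.

Lemma form1_starN eta : (- eta)^# = - eta^#.
Proof.
rewrite -scaleN1r form1_starZ starN star1 -scaleN1r.
have -> : -1 = (-1)%:A :> A by rewrite scaleN1r.
by rewrite form1_mulr_alg.
Qed.

Lemma basis_star a : (e a)^# = e a.
Proof.
rewrite /form1_star (bigD1 a) //= big1 ?addr0 => [|b ba].
  by rewrite ffunE eqxx star1 form1_mulr1.
by rewrite ffunE (negPf ba) star0 form1_mulr0.
Qed.

(** For dt, the starred correction term is lam [pd i] (r ([star f]) r^-1) dx_i, with sign changed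
    because lam is imaginary. It cancels the correction produced by moving r ([star f]) r^-1 through
    dt. *)
Lemma basis_star_mulr a f : (e a ** f)^# = star f *: e a.
Proof.
case: a => [i|].
  by rewrite basis_mulr_Some form1_starZ basis_star basis_mulr_Some.
rewrite basis_mulr_None form1_starD form1_starN !form1_starZ form1_star_sum.
under eq_bigr => i _ do rewrite form1_starZ basis_star basis_mulr_Some star_pd.
rewrite basis_star star_alg conjc_lam form1_mulr_alg star_shift.
by rewrite basis_mulr_None shift_unconj !scaleNr opprK subrK.
Qed.

Lemma form1_star_mulr eta f : (eta ** f)^# = star f *: eta^#.
Proof.
rewrite [in LHS](form1_basis eta) form1_mulr_suml form1_star_sum.
rewrite [in RHS]/form1_star scaler_sumr; apply: eq_bigr => a _.
by rewrite form1_mulrZl form1_starZ basis_star_mulr form1_mulrZl.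
Qed.

(** The star brings the coefficients of [zeta] to the left of [eta^#]; from there they cross the
    tensor sign to the right of the basis forms and reassemble [zeta^#]. *)
Lemma flip_star_tensor eta zeta :
  flip_star F star (tensor eta zeta) = tensor zeta^# eta^#.
Proof.
rewrite /flip_star [in RHS]/form1_star tensor_suml; apply: eq_bigr => b _.
by rewrite ffunE form1_star_mulr tensorZr.
Qed.

Lemma flip_starD (g1 g2 : form2 n A) :
  flip_star F star (g1 + g2) = flip_star F star g1 + flip_star F star g2.
Proof.
rewrite /flip_star -big_split; apply: eq_bigr => b _.
by rewrite ffunE form1_starD tensorDr.
Qed.

Lemma flip_starZ (c : R[i]) (g : form2 n A) :
  flip_star F star (c%:A *: g) = ((c^*)%C%:A : A) *: flip_star F star g.
Proof.
rewrite /flip_star scaler_sumr; apply: eq_bigr => b _.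
by rewrite ffunE form1_starZ star_alg form1_mulr_alg tensorZr form1_mulr_alg tensorZl.
Qed.

Lemma flip_star_sum (I : finType) (g : I -> form2 n A) :
  flip_star F star (\sum_i g i) = \sum_i flip_star F star (g i).
Proof.
elim/big_rec2: _ => [|i y1 y2 _ <-]; last exact: flip_starD.
rewrite -[X in flip_star F star X](scale0r (0 : form2 n A)) -(scale0r (1 : A)).
by rewrite flip_starZ conjc0 !scale0r.
Qed.

End Star.
End Bimodule.

(** * Angular and radial forms *)

Section Lin4.
Variables (B : pzRingType) (V : lmodType B) (w x y z : V).

(** Serves both for the tensors of dr, dt and for those of dr, v. Working with arbitrary vectors
    keeps the linear algebra away from the coordinates of forms. *)
Definition lin4 (a b c d : B) : V := a *: w + b *: x + c *: y + d *: z.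

Lemma lin4D a b c d a' b' c' d' :
  lin4 a b c d + lin4 a' b' c' d' = lin4 (a + a') (b + b') (c + c') (d + d').
Proof.
rewrite /lin4 !scalerDl addrACA; congr (_ + _).
by rewrite addrACA; congr (_ + _); rewrite addrACA.
Qed.

Lemma lin4Z f a b c d : f *: lin4 a b c d = lin4 (f * a) (f * b) (f * c) (f * d).
Proof. by rewrite /lin4 !scalerDr !scalerA. Qed.

Lemma lin4N a b c d : - lin4 a b c d = lin4 (- a) (- b) (- c) (- d).
Proof. by rewrite -scaleN1r lin4Z !mulN1r. Qed.

Lemma addr_lin4 u a b c d :
  u + a *: w + b *: x + c *: y + d *: z = u + lin4 a b c d.
Proof. by rewrite /lin4 !addrA. Qed.

End Lin4.

(** For w, x, y, z the tensors dr (x) dr, dr (x) dt, dt (x) dr, dt (x) dt, the left side is built on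
    dr (x) dr, dr (x) v, v (x) dr, v (x) v. Since r and t do not commute, r t and t r are kept
    apart. *)
Lemma lin4_change_basis (B : pzRingType) (V : lmodType B) (w x y z : V)
    (r t a b c d : B) :
  lin4 w (r *: x - t *: w) (r *: y - t *: w)
       (r *: (r *: z - t *: x) - t *: (r *: y - t *: w)) a b c d =
  lin4 w x y z (a - b * t - c * t + d * (t * t)) (b * r - d * (r * t))
       (c * r - d * (t * r)) (d * (r * r)).
Proof.
have wE : w = lin4 w x y z 1 0 0 0 by rewrite /lin4 !scale0r scale1r !addr0.
have xE : x = lin4 w x y z 0 1 0 0 by rewrite /lin4 !scale0r scale1r add0r !addr0.
have yE : y = lin4 w x y z 0 0 1 0 by rewrite /lin4 !scale0r scale1r !add0r addr0.
have zE : z = lin4 w x y z 0 0 0 1 by rewrite /lin4 !scale0r scale1r !add0r.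
rewrite {1}/lin4.
(* [lin4 w x y z] becomes an opaque linear map, so that only coefficients remain to be compared. *)
move: (lin4 w x y z) (@lin4D _ _ w x y z) (@lin4Z _ _ w x y z)
  (@lin4N _ _ w x y z) wE xE yE zE => L LD LZ LN -> -> -> ->.
rewrite !(LZ, LN, LD).
by congr (L _ _ _ _); rewrite ?(mulr0, mulr1, oppr0, addr0, add0r, subr0, mulrN,
  mulrDr, opprK, sub0r).
Qed.

Section AngularAndRadialForms.
Variables (R : realType) (n : nat) (lam : R[i]) (A : algType R[i]).
Variable F : @function_algebra R n lam A.

Local Notation Om := (form1 n A).
Local Notation X := (fa_X F).
Local Notation t := (fa_t F).
Local Notation r := (fa_r F).
Local Notation rV := (fa_rV F).
Local Notation pd := (fa_pd F).
Local Notation tensor := (tensor F).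
Local Notation dir := (dir F).
Local Notation dr := (dr F).
Local Notation dt := (dt F).
Local Notation angular := (angular F).
Local Notation "eta ** f" := (form1_mulr F eta f) (at level 40, left associativity).
Local Notation e := (@basis_form R n A).

Implicit Types (f h : A) (eta zeta : Om) (g : form2 n A).

Lemma dr_basis : dr = \sum_i dir i *: e (Some i).
Proof.
rewrite [LHS]form1_basis big_option !ffunE shift_r subrr scaler0 scale0r add0r.
by apply: eq_bigr => i _; rewrite !ffunE pd_r.
Qed.

Lemma drE_Some i : dr (Some i) = dir i.
Proof. by rewrite !ffunE pd_r. Qed.

Lemma drE_None : dr None = 0.
Proof. by rewrite !ffunE shift_r subrr scaler0. Qed.

Lemma ext_d_X i : ext_d F (X i) = e (Some i).
Proof.
apply/ffunP => -[j|]; rewrite !ffunE; last by rewrite shift_X subrr scaler0.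
by rewrite pd_X (inj_eq Some_inj).
Qed.

Lemma dr_mulr f : dr ** f = f *: dr.
Proof.
rewrite dr_basis form1_mulr_suml scaler_sumr; apply: eq_bigr => i _.
by rewrite form1_mulrZl basis_mulr_Some !scalerA dir_comm.
Qed.

(** The projection tangent to the sphere, whose rows are the coefficients of the omega_i. *)
Definition proj i j : A := (i == j)%:R - dir i * dir j.

Lemma proj_comm i j f : proj i j * f = f * proj i j.
Proof.
rewrite mulrBl mulrBr; congr (_ - _); first by rewrite commr_nat.
by rewrite -mulrA (dir_comm F j f) mulrA (dir_comm F i f) mulrA.
Qed.

Lemma omega_basis i : omega F i = \sum_j proj i j *: e (Some j).
Proof.
apply: eq_bigr => j _; rewrite /dX ext_d_X /proj; congr ((_ - _) *: _).
by rewrite (dirE F i) -(mulrA _ rV) -(dir_comm F j rV) dirE expr2 !mulrA.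
Qed.

Lemma omega_mulr i f : omega F i ** f = f *: omega F i.
Proof.
rewrite omega_basis form1_mulr_suml scaler_sumr; apply: eq_bigr => j _.
by rewrite form1_mulrZl basis_mulr_Some !scalerA proj_comm.
Qed.

Lemma angular_mulr f : form2_mulr F angular f = f *: angular.
Proof.
rewrite form2_mulr_sum scaler_sumr; apply: eq_bigr => i _.
by rewrite tensor_comm // omega_mulr.
Qed.

Lemma omegaE_Some i j : omega F i (Some j) = proj i j.
Proof.
rewrite omega_basis form1_sumE (bigD1 j) //= big1 => [|k kj].
  by rewrite form1_scaleE ffunE eqxx mulr1 addr0.
by rewrite form1_scaleE ffunE (inj_eq Some_inj) eq_sym (negPf kj) mulr0.
Qed.

Lemma omegaE_None i : omega F i None = 0.
Proof.
rewrite omega_basis form1_sumE big1 // => k _.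
by rewrite form1_scaleE ffunE mulr0.
Qed.

Lemma angularE_SS i j :
  angular (Some j) (Some i) = \sum_k proj k i * proj k j.
Proof.
rewrite form2_sumE form1_sumE; apply: eq_bigr => k _.
by rewrite ffunE omega_mulr form1_scaleE !omegaE_Some proj_comm.
Qed.

Lemma angularE_NS i : angular None (Some i) = 0.
Proof.
rewrite form2_sumE form1_sumE big1 // => k _.
by rewrite ffunE omega_mulr form1_scaleE omegaE_None mul0r.
Qed.

Lemma angularE_SN j : angular (Some j) None = 0.
Proof.
rewrite form2_sumE form1_sumE big1 // => k _.
by rewrite ffunE omega_mulr form1_scaleE omegaE_None mulr0.
Qed.

Lemma angularE_NN : angular None None = 0.
Proof.
rewrite form2_sumE form1_sumE big1 // => k _.
by rewrite ffunE omega_mulr form1_scaleE omegaE_None mulr0.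
Qed.

Definition rt_form : A -> A -> A -> A -> form2 n A :=
  lin4 (tensor dr dr) (tensor dr dt) (tensor dt dr) (tensor dt dt).

Hypothesis lam_neq0 : lam != 0.

Lemma dt_basis : dt = e None.
Proof.
apply/ffunP => -[i|]; rewrite !ffunE ?pd_t // shift_t opprB addrC subrK.
by rewrite scalerA mulVf // scale1r.
Qed.

Lemma tensor_drr i j : tensor dr dr (Some j) (Some i) = dir i * dir j.
Proof. by rewrite tensorE dr_mulr form1_scaleE !drE_Some dir_comm. Qed.

(** Moving a coefficient of dr leftwards past dt costs -lam times its gradient, so dt (x) dr has
    dx_i (x) dx_j components. *)
Lemma tensor_dtr i j : tensor dt dr (Some j) (Some i) = - (lam *: pd i (dir j)).
Proof.
by rewrite dt_basis tensorE form1_mulr_SomeE drE_Some !basis_formE mul0r mul1r sub0r.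
Qed.

Lemma tensor_dt (eta : Om) b a :
  tensor eta dt b a = if b is None then eta a else 0.
Proof.
rewrite dt_basis tensorE basis_formE; case: b => [i|] /=; last by rewrite form1_mulr1.
by rewrite form1_mulr0 ffunE.
Qed.

Lemma tensor_dr_None (eta : Om) a : tensor eta dr None a = 0.
Proof. by rewrite tensorE drE_None form1_mulr0 ffunE. Qed.

Lemma tensor_dr_SN j : tensor dr dr (Some j) None = 0.
Proof. by rewrite tensorE dr_mulr form1_scaleE drE_None mulr0. Qed.

Lemma tensor_dtr_SN j : tensor dt dr (Some j) None = dir j.
Proof.
rewrite dt_basis tensorE form1_mulr_NoneE drE_Some basis_formE mul1r.
by rewrite dirE fa_shiftM shift_X shift_rV.
Qed.

Lemma form2_addE (g1 g2 : form2 n A) b a : (g1 + g2) b a = g1 b a + g2 b a.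
Proof. by rewrite ffunE ffunE. Qed.

Lemma rt_formE a b c d k l : rt_form a b c d l k =
  a * tensor dr dr l k + b * tensor dr dt l k + c * tensor dt dr l k
  + d * tensor dt dt l k.
Proof.
rewrite /rt_form /lin4 3!form2_addE.
by congr (_ + _ + _ + _); exact: form2_scaleE.
Qed.

Lemma rt_formE_SS a b c d i j : rt_form a b c d (Some j) (Some i) =
  a * (dir i * dir j) - c * (lam *: pd i (dir j)).
Proof.
rewrite rt_formE tensor_drr tensor_dtr !tensor_dt.
by rewrite !mulr0 !addr0 mulrN.
Qed.

Lemma rt_formE_NS a b c d i : rt_form a b c d None (Some i) = b * dir i.
Proof.
rewrite rt_formE !tensor_dr_None !tensor_dt dt_basis drE_Some basis_formE.
by rewrite !mulr0 add0r !addr0.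
Qed.

Lemma rt_formE_SN a b c d j : rt_form a b c d (Some j) None = c * dir j.
Proof.
rewrite rt_formE tensor_dr_SN tensor_dtr_SN !tensor_dt.
by rewrite !mulr0 !addr0 add0r.
Qed.

Lemma rt_formE_NN a b c d : rt_form a b c d None None = d.
Proof.
rewrite rt_formE !tensor_dr_None !tensor_dt dt_basis drE_None basis_formE.
by rewrite !mulr0 !add0r mulr1.
Qed.

Lemma rt_form_eq0 a b c d : rt_form a b c d = 0 -> [/\ a = 0, b = 0, c = 0 & d = 0].
Proof.
move=> abcd0; have coef0 l k : rt_form a b c d l k = 0.
  by rewrite abcd0 ffunE ffunE.
have dir0 f : (forall i, f * dir i = 0) -> f = 0.
  by move=> f0; apply: (@dir_inj _ _ _ _ F) => i; rewrite f0 mul0r.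
(* The coefficient c is settled first because it also enters the dx_i (x) dx_j entries through the
   Hessian of r; without it these entries determine a. *)
have c0 : c = 0 by apply: dir0 => i; rewrite -(rt_formE_SN a b c d) coef0.
split=> //; last by rewrite -(rt_formE_NN a b c d) coef0.
  apply: (dir0 a) => i; apply: dir0 => j; rewrite -mulrA.
  by rewrite -(coef0 (Some j) (Some i)) rt_formE_SS c0 mul0r subr0.
by apply: dir0 => i; rewrite -(rt_formE_NS a b c d) coef0.
Qed.

Lemma rt_form_inj a b c d a' b' c' d' :
  rt_form a b c d = rt_form a' b' c' d' -> [/\ a = a', b = b', c = c' & d = d'].
Proof.
move/eqP; rewrite -subr_eq0 lin4N lin4D => /eqP /rt_form_eq0[].
by move=> /subr0_eq -> /subr0_eq -> /subr0_eq -> /subr0_eq ->.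
Qed.

Lemma form2_eq g1 g2 : (forall b a, g1 b a = g2 b a) -> g1 = g2.
Proof. by move=> g12; apply/ffunP => b; apply/ffunP => a. Qed.

Lemma quantum_symmetricP g : quantum_symmetric g <-> forall k l, g l k = g k l.
Proof.
split=> [g0 k l|gC].
  have := congr1 (fun w : {ffun _ -> A} => w (k, l)) g0.
  by rewrite ffunE [RHS]ffunE => /eqP; rewrite subr_eq0 => /eqP.
by apply/ffunP => -[k l]; rewrite ffunE [RHS]ffunE /= gC subrr.
Qed.

(* The dx_i (x) dx_j part of dt (x) dr is symmetric because the Hessian of r is. *)
Lemma rt_form_symmetric a b c d :
  (forall i, b * dir i = c * dir i) <-> quantum_symmetric (angular + rt_form a b c d).
Proof.
split=> [bc|/quantum_symmetricP gC i]; last first.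
  have := gC (Some i) None; rewrite !(form2_addE angular).
  by rewrite rt_formE_NS rt_formE_SN angularE_NS angularE_SN !add0r.
apply/quantum_symmetricP => k l; rewrite !(form2_addE angular).
case: k l => [i|] [j|]; rewrite ?(rt_formE_SS, rt_formE_NS, rt_formE_SN)
  ?(angularE_SS, angularE_NS, angularE_SN) ?bc //.
congr (_ + (_ - _)).
- by apply: eq_bigr => k _; rewrite proj_comm.
- by rewrite dir_comm.
- by rewrite !pd_dir eq_sym dir_comm.
Qed.

End AngularAndRadialForms.

(** * The central basis dr, v *)

Section CentralBasis.
Variables (R : realType) (n : nat) (lam : R[i]) (A : algType R[i]).
Variable F : @function_algebra R n lam A.

Local Notation Om := (form1 n A).
Local Notation X := (fa_X F).
Local Notation t := (fa_t F).
Local Notation r := (fa_r F).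
Local Notation rV := (fa_rV F).
Local Notation shift := (fa_shift F).
Local Notation pd := (fa_pd F).
Local Notation tensor := (tensor F).
Local Notation dr := (dr F).
Local Notation dt := (dt F).
Local Notation v := (v F).
Local Notation angular := (angular F).
Local Notation rt_form := (rt_form F).
Local Notation "eta ** f" := (form1_mulr F eta f) (at level 40, left associativity).
Local Notation e := (@basis_form R n A).

Implicit Types (f h : A) (eta zeta : Om) (g : form2 n A).

Hypotheses (i0 : 'I_n.-1) (lam_neq0 : lam != 0).

Lemma alg_comm (c : R[i]) f : f * c%:A = c%:A * f.
Proof. by rewrite mulr_algl mulr_algr. Qed.

(** Moving f through r dt leaves the correction -lam ([euler]) dr, and t f = f t - lam ([euler])
    produces the same correction in t dr; they cancel in the difference. *)
Lemma v_mulr f : fun_of_rt F f -> v ** f = f *: v.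
Proof.
move=> f_rt; rewrite form1_mulrDl form1_mulrNl !form1_mulrZl dr_mulr.
rewrite {1}(dt_basis F lam_neq0) basis_mulr_None -(dt_basis F lam_neq0) scalerA fa_crosst.
set euler := \sum_i X i * pd i f.
have -> : r *: (shift f *: dt - lam%:A *: \sum_i pd i f *: e (Some i)) =
    (f * r) *: dt - lam%:A *: (euler *: dr).
  rewrite scalerBr scalerA -fa_crossr; congr (_ - _).
  rewrite [LHS]scalerA alg_comm -[LHS]scalerA; congr (_ *: _).
  rewrite dr_basis !scaler_sumr; apply: eq_bigr => i _.
  by rewrite !scalerA (r_pd_radial i0) // dir_comm.
rewrite scalerBl -(mulr_algl lam euler) -(scalerA _ euler) opprB addrA subrK.
by rewrite scalerBr !scalerA.
Qed.

Lemma fun_of_rt_r : fun_of_rt F r.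
Proof. by move=> x y s sx sy xy; rewrite !fa_rE // xy. Qed.

Lemma fun_of_rt_t : fun_of_rt F t.
Proof. by move=> x y s sx sy xy; rewrite !fa_tE. Qed.

Definition central_form : A -> A -> A -> A -> form2 n A :=
  lin4 (tensor dr dr) (tensor dr v) (tensor v dr) (tensor v v).

Lemma central_form_mulr a b c d f : fun_of_rt F f ->
  form2_mulr F (central_form a b c d) f = central_form (a * f) (b * f) (c * f) (d * f).
Proof.
move=> f_rt; rewrite /central_form /lin4 3!form2_mulrD.
have cf w x y : form2_mulr F (tensor w x) f = f *: tensor w x ->
    form2_mulr F (y *: tensor w x) f = (y * f) *: tensor w x.
  by move=> wx; rewrite form2_mulrZ wx scalerA.
congr (_ + _ + _ + _); apply: cf; apply: tensor_comm; rewrite ?dr_mulr //;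
  exact: v_mulr.
Qed.

Lemma central_formE a b c d : central_form a b c d =
  rt_form (a - b * t - c * t + d * (t * t)) (b * r - d * (r * t))
          (c * r - d * (t * r)) (d * (r * r)).
Proof.
have tensor_v w : tensor v w = r *: tensor dt w - t *: tensor dr w.
  by rewrite tensorDl tensorNl !tensorZl.
have dr_v : tensor dr v = r *: tensor dr dt - t *: tensor dr dr.
  by rewrite tensorDr tensorNr !tensorZr !dr_mulr !tensorZl.
have vZ f w : fun_of_rt F f -> tensor v (f *: w) = f *: tensor v w.
  by move=> f_rt; rewrite tensorZr v_mulr // tensorZl.
have v_v : tensor v v = r *: tensor v dt - t *: tensor v dr.
  rewrite -(vZ _ _ fun_of_rt_r) -(vZ _ _ fun_of_rt_t) -tensorNr.
  by rewrite -tensorDr.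
rewrite /central_form v_v !tensor_v dr_v; exact: lin4_change_basis.
Qed.

Lemma mulr_r_eq0 f : f * r = 0 -> f = 0.
Proof. by move=> fr0; rewrite -[f]mulr1 -(rrVK F) mulrA fr0 mul0r. Qed.

Lemma central_form_eq0 a b c d :
  central_form a b c d = 0 -> [/\ a = 0, b = 0, c = 0 & d = 0].
Proof.
rewrite central_formE => /(rt_form_eq0 lam_neq0)[a0 b0 c0 d0].
have {}d0 : d = 0 by move: d0; rewrite mulrA => /mulr_r_eq0/mulr_r_eq0.
move: a0 b0 c0; rewrite d0 !mul0r !subr0 addr0 => a0 /mulr_r_eq0 b0 /mulr_r_eq0 c0.
by move: a0; rewrite b0 c0 !mul0r !subr0.
Qed.

Lemma rt_form_central a b c d : exists P Q S T, rt_form a b c d = central_form P Q S T.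
Proof.
suff [P [Q [S [T [<- <- <- <-]]]]] : exists P Q S T,
    [/\ P - Q * t - S * t + T * (t * t) = a, Q * r - T * (r * t) = b,
        S * r - T * (t * r) = c & T * (r * r) = d].
  by exists P, Q, S, T; rewrite central_formE.
have rK f : f * rV * r = f by rewrite -mulrA rVrK mulr1.
(* The triangular system is solved from its last equation upwards, dividing by r on the right. *)
set T := d * rV * rV; set Q := (b + T * (r * t)) * rV.
set S := (c + T * (t * r)) * rV.
exists (a - T * (t * t) + S * t + Q * t), Q, S, T; split.
- by rewrite !addrK subrK.
- by rewrite rK addrK.
- by rewrite rK addrK.
- by rewrite mulrA !rK.
Qed.

Lemma central_form_inj a b c d a' b' c' d' :
  central_form a b c d = central_form a' b' c' d' ->
  [/\ a = a', b = b', c = c' & d = d'].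
Proof.
move/eqP; rewrite -subr_eq0 lin4N lin4D => /eqP /central_form_eq0[].
by move=> /subr0_eq -> /subr0_eq -> /subr0_eq -> /subr0_eq ->.
Qed.

(* [locked] keeps failing unifications from unfolding the forms. *)
Definition const_form (a b c d : R[i]) : form2 n A :=
  locked (central_form a%:A b%:A c%:A d%:A).

Lemma const_formE a b c d : const_form a b c d = central_form a%:A b%:A c%:A d%:A.
Proof. by rewrite /const_form -lock. Qed.

Lemma eq_const_form a b c d a' b' c' d' : a = a' -> b = b' -> c = c' -> d = d' ->
  const_form a b c d = const_form a' b' c' d'.
Proof. by move=> -> -> -> ->. Qed.

Lemma const_formD a b c d a' b' c' d' :
  const_form a b c d + const_form a' b' c' d' =
  const_form (a + a') (b + b') (c + c') (d + d').
Proof. by rewrite !const_formE [LHS]lin4D -!scalerDl. Qed.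

Lemma const_formZ k a b c d :
  (k%:A : A) *: const_form a b c d = const_form (k * a) (k * b) (k * c) (k * d).
Proof. by rewrite !const_formE [LHS]lin4Z !mulr_algl !scalerA. Qed.

Lemma const_formN a b c d : - const_form a b c d = const_form (- a) (- b) (- c) (- d).
Proof. by rewrite !const_formE [LHS]lin4N -!scaleNr. Qed.

Lemma const_form_inj a b c d a' b' c' d' :
  const_form a b c d = const_form a' b' c' d' ->
  [/\ a = a', b = b', c = c' & d = d'].
Proof.
have algI (k l : R[i]) : k%:A = l%:A :> A -> k = l.
  move/eqP; rewrite -subr_eq0 -scalerBl scaler_eq0 oner_eq0 orbF subr_eq0.
  by move/eqP.
by rewrite !const_formE => /central_form_inj[/algI ? /algI ? /algI ? /algI ?].
Qed.

Lemma tensor_drr_const : tensor dr dr = const_form 1 0 0 0.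
Proof. by rewrite const_formE /central_form /lin4 !scale0r !scale1r !addr0. Qed.

Lemma tensor_drv_const : tensor dr v = const_form 0 1 0 0.
Proof. by rewrite const_formE /central_form /lin4 !scale0r !scale1r add0r !addr0. Qed.

Lemma tensor_vdr_const : tensor v dr = const_form 0 0 1 0.
Proof. by rewrite const_formE /central_form /lin4 !scale0r !scale1r !add0r addr0. Qed.

Lemma tensor_vv_const : tensor v v = const_form 0 0 0 1.
Proof. by rewrite const_formE /central_form /lin4 !scale0r !scale1r !add0r. Qed.

Lemma const_form_mulr a b c d f : fun_of_rt F f ->
  form2_mulr F (const_form a b c d) f = f *: const_form a b c d.
Proof.
move=> f_rt; rewrite const_formE (central_form_mulr _ _ _ _ f_rt) lin4Z.
by rewrite !alg_comm.
Qed.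

(** The form v (x) v contributes -d r t to the coefficient of dr (x) dt but -d t r to that of dt (x)
    dr, and t r = r t - lam r accounts for the term lam d. *)
Lemma const_form_symmetric a b c d :
  quantum_symmetric (angular + const_form a b c d) <-> b = c + lam * d.
Proof.
rewrite const_formE central_formE.
apply: (iff_trans (iff_sym (rt_form_symmetric F lam_neq0 _ _ _ _))); split=> [bc|-> i].
  have {}bc := dir_inj bc.
  move: bc; rewrite t_r !mulr_algl scalerBr opprB addrA => /addIr /eqP.
  rewrite scalerA -scalerDl -subr_eq0 -scalerBl scaler_eq0 subr_eq0 mulrC.
  case/orP=> [/eqP //|/eqP r0].
  by have := rVrK F; rewrite r0 mulr0 => /esym/eqP; rewrite oner_eq0.
congr (_ * _); rewrite t_r !mulr_algl scalerBr opprB addrA; congr (_ - _).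
by rewrite scalerA -scalerDl mulrC.
Qed.

End CentralBasis.

(** * Commutation with functions of r and t; translations *)

Section Classification.
Variables (R : realType) (n : nat) (lam : R[i]) (A : algType R[i]).
Variable F : @function_algebra R n lam A.

Local Notation t := (fa_t F).
Local Notation r := (fa_r F).
Local Notation rV := (fa_rV F).
Local Notation shift := (fa_shift F).
Local Notation pd := (fa_pd F).
Local Notation symb := (fa_symb F).
Local Notation dir := (dir F).
Local Notation proj := (proj F).
Local Notation angular := (angular F).
Local Notation rt_form := (rt_form F).
Local Notation central_form := (central_form F).
Local Notation const_form := (const_form F).
Local Notation "eta ** f" := (form1_mulr F eta f) (at level 40, left associativity).

Implicit Types (f h : A) (g : form2 n A).

Hypotheses (i0 : 'I_n.-1) (lam_neq0 : lam != 0).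

Section NullModeFree.
Variables (K : A -> Prop) (K_class : null_mode_free F K).

Lemma nmf0 : K 0.
Proof.
rewrite -(addNr (1 : A)) -scaleN1r.
exact: nmf_lin K_class _ _ _ (nmf_1 K_class) (nmf_1 K_class).
Qed.

Lemma nmfD f h : K f -> K h -> K (f + h).
Proof. by rewrite -{2}(scale1r f); exact: (nmf_lin K_class). Qed.

Lemma nmfZ c f : K f -> K (c *: f).
Proof. by move=> Kf; rewrite -[_ *: _]addr0; exact: (nmf_lin K_class c Kf nmf0). Qed.

Lemma nmfN f : K f -> K (- f).
Proof. by rewrite -scaleN1r; exact: nmfZ. Qed.

Lemma nmf_alg c f : K f -> K (c%:A * f).
Proof. by rewrite mulr_algl; exact: nmfZ. Qed.

Lemma nmf_const f : K f -> r * f = f * r -> t * f = f * t -> exists c, f = c%:A.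
Proof.
move=> Kf rf tf; have f_rt := nmf_rt K_class Kf.
have f_t := fun_of_t_central i0 f_rt lam_neq0 tf.
apply: contrapT => f_nonconst; apply: (nmf_null K_class Kf); split=> //.
have shift_f : shift f = f.
  by rewrite shift_conj -mulrA -rf mulrA rVrK mul1r.
by move=> x s sx; rewrite -[in RHS]shift_f fa_shiftE.
Qed.

Lemma commuting_central_form a b c d :
  commutes_with_rt F (angular + central_form a b c d) ->
  forall f, fun_of_rt F f ->
  [/\ f * a = a * f, f * b = b * f, f * c = c * f & f * d = d * f].
Proof.
move=> g_comm f f_rt; have := g_comm f f_rt.
rewrite (form2_mulrD F angular) (angular_mulr F f).
rewrite (central_form_mulr i0 lam_neq0 _ _ _ _ f_rt) (scalerDr f angular) => /addrI.
by rewrite [X in X = _]lin4Z => /(central_form_inj i0 lam_neq0).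
Qed.

Lemma commuting_const_form g :
  standard_angular_part F K g -> commutes_with_rt F g ->
  exists a b c d, g = angular + const_form a b c d.
Proof.
move=> [prr [prt [ptr [ptt [Krr Krt Ktr Ktt gE]]]]].
have {}gE : g = angular + rt_form prr prt ptr ptt by rewrite gE; exact: addr_lin4.
have [P [Q [S [T pE]]]] := rt_form_central F i0 lam_neq0 prr prt ptr ptt.
rewrite {}gE => g_comm.
suff [[a aE] [b bE] [c cE] [d dE]] : [/\ exists a, P = a%:A, exists b, Q = b%:A,
    exists c, S = c%:A & exists d, T = d%:A].
  by exists a, b, c, d; rewrite const_formE pE aE bE cE dE.
move: g_comm; rewrite pE => /commuting_central_form PQST_comm.
have [Pr Qr Sr Tr] := PQST_comm _ (@fun_of_rt_r _ _ _ _ F).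
have [Pt Qt St Tt] := PQST_comm _ (@fun_of_rt_t _ _ _ _ F).
move: pE; rewrite (central_formE F i0 lam_neq0).
move=> /(rt_form_inj lam_neq0)[rrE rtE trE ttE].
have rVK f : rV * (r * f) = f by rewrite mulrA rVrK mul1r.
have [d dE] : exists d, T = d%:A.
  apply: nmf_const => //.
  have -> : T = rV * (rV * ptt).
    by rewrite ttE (mulrA T) -Tr -(mulrA r) -Tr !rVK.
  by do 2!apply: (nmf_rV K_class).
have Kt : K t by rewrite -(mul1r t); apply: (nmf_t K_class) (nmf_1 K_class).
have [b bE] : exists b, Q = b%:A.
  apply: nmf_const => //.
  have -> : Q = rV * prt + d%:A * t.
    by rewrite rtE -Qr mulrBr rVK dE -(alg_comm d (r * t)) -(mulrA r) rVK alg_comm subrK.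
  by apply: nmfD; [exact: (nmf_rV K_class)|exact: nmf_alg].
have [c cE] : exists c, S = c%:A.
  apply: nmf_const => //.
  have -> : S = rV * ptr + (d%:A * t - (d * lam)%:A).
    have tr : rV * (d%:A * (t * r)) = d%:A * t - (d * lam)%:A.
      (* Normal ordering t r = r t - lam r yields a right factor t, which [K] admits, and the
         constant d lam. *)
      rewrite -(alg_comm d (t * r)) t_r mulrBl mulrBr -(mulrA r) rVK alg_comm.
      by rewrite mulr_algr -!scalerAr rVrK scalerA.
    by rewrite trE -Sr mulrBr rVK dE tr subrK.
  apply: nmfD; first exact: (nmf_rV K_class).
  by apply: nmfD; [exact: nmf_alg|apply/nmfN/nmfZ/(nmf_1 K_class)].
have [a aE] : exists a, P = a%:A.
  apply: nmf_const => //.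
  have -> : P = prr - T * (t * t) + S * t + Q * t by rewrite rrE addrK !subrK.
  rewrite bE cE dE; do 2!(apply: nmfD; last exact: nmf_alg).
  by apply: nmfD => //; apply/nmfN/nmf_alg/(nmf_t K_class).
by split; [exists a|exists b|exists c|exists d].
Qed.

End NullModeFree.

(** * Translations of the time variable *)

Section Translation.
Variable beta : R.

Definition translated f h := forall x s, spatial x -> symb h x s = symb f x (s + beta%:C).

Lemma translatedD f h f' h' :
  translated f h -> translated f' h' -> translated (f + f') (h + h').
Proof. by move=> fh fh' x s sx; rewrite !symbD // fh // fh'. Qed.

Lemma translated_eq f f' h h' : f = f' -> h = h' -> translated f' h' -> translated f h.
Proof. by move=> -> ->. Qed.

Lemma translatedZ c f h : translated f h -> translated (c *: f) (c *: h).
Proof. by move=> fh x s sx; rewrite !symbZ // fh. Qed.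

Lemma translatedN f h : translated f h -> translated (- f) (- h).
Proof. by move=> fh x s sx; rewrite !symbN // fh. Qed.

Lemma translated_alg c : translated c%:A c%:A.
Proof. by move=> x s sx; rewrite !symb_alg. Qed.

Lemma translated_sum (I : finType) (f h : I -> A) :
  (forall i, translated (f i) (h i)) -> translated (\sum_i f i) (\sum_i h i).
Proof.
by move=> fh x s sx; rewrite !symb_sum //; apply: eq_bigr => i _; rewrite fh.
Qed.

Lemma translated_dir i f h : translated f h -> translated (dir i * f) (dir i * h).
Proof.
by move=> fh x s sx; rewrite dirE -!mulrA !symb_Xl // !symb_rVl // fh.
Qed.

(** Right multiplication by 1/r is left multiplication after the inverse shift t |-> t + lam, and
    this shift commutes with the translation by beta. *)
Lemma translated_rV f h : translated f h -> translated (f * rV) (h * rV).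
Proof.
move=> fh x s sx; rewrite (mulr_rV F f) (mulr_rV F h) !symb_rVl //; congr (_ * _).
have unshift k u : symb (r * k * rV) x u = symb k x (u + lam).
  by rewrite -[in RHS](shift_unconj F k) fa_shiftE // addrK.
by rewrite !unshift fh // addrAC.
Qed.

Lemma translated_proj i j f h :
  translated f h -> translated (proj i j * f) (proj i j * h).
Proof.
move=> fh; rewrite !mulrBl -!mulrA; apply: translatedD.
  rewrite !mulr_natl; case: (i == j); rewrite ?mulr1n // !mulr0n.
  by rewrite -[0](scale0r (1 : A)); exact: translated_alg.
by apply/translatedN/translated_dir/translated_dir.
Qed.

Lemma time_translateD (g1 g2 h1 h2 : form2 n A) :
  time_translate F beta g1 h1 -> time_translate F beta g2 h2 ->
  time_translate F beta (g1 + g2) (h1 + h2).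
Proof.
by move=> gh1 gh2 k l x s sx; rewrite !form2_addE !symbD // gh1 // gh2.
Qed.

Lemma time_translate_angular : time_translate F beta angular angular.
Proof.
have tr0 : translated 0 0 by rewrite -[0](scale0r (1 : A)); exact: translated_alg.
have tr1 : translated 1 1 by rewrite -[1](scale1r (1 : A)); exact: translated_alg.
suff tr l k : translated (angular l k) (angular l k) by move=> k l; exact: tr.
case: l k => [j|] [i|]; rewrite ?angularE_SS ?angularE_NS ?angularE_SN ?angularE_NN //.
apply: translated_sum => k; apply: translated_proj.
by rewrite -[proj k j]mulr1; exact: translated_proj.
Qed.

Lemma time_translate_rt_form a b c d a' b' c' d' :
  translated a a' -> translated b b' -> translated c c' -> translated d d' ->
  time_translate F beta (rt_form a b c d) (rt_form a' b' c' d').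
Proof.
move=> aa bb cc dd.
suff tr l k : translated (rt_form a b c d l k) (rt_form a' b' c' d' l k).
  by move=> k l; exact: tr.
case: l k => [j|] [i|].
- apply: translated_eq (rt_formE_SS F lam_neq0 _ _ _ _ _ _)
    (rt_formE_SS F lam_neq0 _ _ _ _ _ _) _.
  have pdE : pd i (dir j) = proj i j * rV by exact: pd_dir.
  have dirA f : f * (dir i * dir j) = dir i * (dir j * f).
    by rewrite (dir_comm F j f) !mulrA (dir_comm F i f).
  have projA f : f * (proj i j * rV) = proj i j * (f * rV).
    by rewrite !mulrA (proj_comm F i j f).
  rewrite pdE -!scalerAr !dirA !projA; apply: translatedD.
    by apply: translated_dir; apply: translated_dir.
  by apply/translatedN/translatedZ/translated_proj/translated_rV.
- apply: translated_eq (rt_formE_SN F lam_neq0 _ _ _ _ _)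
    (rt_formE_SN F lam_neq0 _ _ _ _ _) _.
  by rewrite -(dir_comm F j c) -(dir_comm F j c'); exact: translated_dir.
- apply: translated_eq (rt_formE_NS F lam_neq0 _ _ _ _ _)
    (rt_formE_NS F lam_neq0 _ _ _ _ _) _.
  by rewrite -(dir_comm F i b) -(dir_comm F i b'); exact: translated_dir.
- exact: translated_eq (rt_formE_NN F lam_neq0 _ _ _ _)
    (rt_formE_NN F lam_neq0 _ _ _ _) dd.
Qed.

End Translation.
End Classification.

(** * Hermiticity *)

Section Hermitian.
Variables (R : realType) (n : nat) (lam : R[i]) (A : algType R[i]).
Variable F : @function_algebra R n lam A.

Local Notation Om := (form1 n A).
Local Notation r := (fa_r F).
Local Notation tensor := (tensor F).
Local Notation proj := (proj F).
Local Notation dr := (dr F).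
Local Notation dt := (dt F).
Local Notation v := (v F).
Local Notation angular := (angular F).
Local Notation const_form := (const_form F).
Local Notation "eta ** f" := (form1_mulr F eta f) (at level 40, left associativity).

Implicit Types (f h : A) (g : form2 n A).

Hypotheses (i0 : 'I_n.-1) (lam_neq0 : lam != 0) (lam_im : complex.Re lam = 0).
Variables (star : A -> A) (star_op : star_operation F star).

Local Notation "eta ^#" := (form1_star F star eta) (at level 2, format "eta ^#").
Local Notation vstar := (vstar F star).
Local Notation flip := (flip_star F star).

Lemma star_proj i j : star (proj i j) = proj i j.
Proof.
rewrite /proj (starD star_op) (starN star_op) (star_M star_op) !(star_dir star_op).
rewrite dir_comm; congr (_ - _).
by case: (i == j); [exact: star1 star_op|exact: star0 star_op].
Qed.

Lemma omega_star i : (omega F i)^# = omega F i.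
Proof.
rewrite omega_basis (form1_star_sum star_op); apply: eq_bigr => j _.
by rewrite (form1_starZ star_op) (basis_star star_op) basis_mulr_Some star_proj.
Qed.

Lemma dr_star : dr^# = dr.
Proof. by rewrite [LHS](star_d star_op) (star_r star_op). Qed.

(** Here v^* = (dt) r - (dr) t with dr central, so the only correction comes from (dt) r = r dt -
    lam dr. *)
Lemma vstarE : vstar = v - lam%:A *: dr.
Proof.
have dt_star : dt^# = dt by rewrite [LHS](star_d star_op) (star_t star_op).
have dt_r : dt ** r = r *: dt - lam%:A *: dr.
  rewrite (dt_basis F lam_neq0) basis_mulr_None shift_r dr_basis.
  by congr (_ - _ *: _); apply: eq_bigr => i _; rewrite pd_r.
rewrite [LHS](form1_starD star_op) (form1_starN star_op) !(form1_starZ star_op).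
rewrite (star_r star_op) (star_t star_op) dt_star dr_star dr_mulr dt_r.
exact: addrAC.
Qed.

Lemma tensorBl (w x y : Om) (c : R[i]) :
  tensor (x - c%:A *: y) w = tensor x w - (c%:A : A) *: tensor y w.
Proof. by rewrite tensorDl tensorNl tensorZl. Qed.

Lemma tensorBr (w x y : Om) (c : R[i]) :
  tensor w (x - c%:A *: y) = tensor w x - (c%:A : A) *: tensor w y.
Proof. by rewrite tensorDr tensorNr tensorZr form1_mulr_alg tensorZl. Qed.

Lemma tensor_vstar_dr : tensor vstar dr = const_form (- lam) 0 1 0.
Proof.
rewrite vstarE tensorBl tensor_vdr_const tensor_drr_const.
by rewrite const_formZ const_formN const_formD !(mulr0, mulr1, oppr0, addr0, add0r).
Qed.

Lemma tensor_dr_vstar : tensor dr vstar = const_form (- lam) 1 0 0.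
Proof.
rewrite vstarE tensorBr tensor_drv_const tensor_drr_const.
by rewrite const_formZ const_formN const_formD !(mulr0, mulr1, oppr0, addr0, add0r).
Qed.

Lemma tensor_vstar_v : tensor vstar v = const_form 0 (- lam) 0 1.
Proof.
rewrite vstarE tensorBl tensor_drv_const tensor_vv_const.
by rewrite const_formZ const_formN const_formD !(mulr0, mulr1, oppr0, addr0, add0r).
Qed.

Lemma tensor_vstar_vstar : tensor vstar vstar = const_form (lam ^+ 2) (- lam) (- lam) 1.
Proof.
rewrite {2}vstarE tensorBr tensor_vstar_v tensor_vstar_dr.
rewrite const_formZ const_formN const_formD.
by apply: eq_const_form; ring.
Qed.

Lemma flip_star_lin4 (g1 g2 g3 g4 : form2 n A) (a b c d : R[i]) :
  flip (lin4 g1 g2 g3 g4 a%:A b%:A c%:A d%:A) =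
  lin4 (flip g1) (flip g2) (flip g3) (flip g4)
    (a^*)%C%:A (b^*)%C%:A (c^*)%C%:A (d^*)%C%:A.
Proof. by rewrite /lin4 !(flip_starD star_op) !(flip_starZ star_op). Qed.

Lemma flip_star_const a b c d : flip (const_form a b c d) =
  const_form ((a^*)%C - lam * (b^*)%C - lam * (c^*)%C + lam ^+ 2 * (d^*)%C)
    ((c^*)%C - lam * (d^*)%C) ((b^*)%C - lam * (d^*)%C) (d^*)%C.
Proof.
have flip_tensor := flip_star_tensor star_op lam_neq0 lam_im.
rewrite [in LHS]const_formE [LHS]flip_star_lin4 !flip_tensor dr_star -/vstar.
rewrite tensor_drr_const tensor_vstar_dr tensor_dr_vstar tensor_vstar_vstar.
rewrite /lin4 !const_formZ !const_formD.
by apply: eq_const_form; ring.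
Qed.

Lemma flip_star_angular : flip angular = angular.
Proof.
rewrite (flip_star_sum star_op); apply: eq_bigr => i _.
by rewrite (flip_star_tensor star_op) // omega_star.
Qed.

Lemma flip_hermitianP a b c d : flip_hermitian F star (angular + const_form a b c d) <->
  [/\ (a^*)%C - lam * (b^*)%C - lam * (c^*)%C + lam ^+ 2 * (d^*)%C = a,
      (c^*)%C - lam * (d^*)%C = b, (b^*)%C - lam * (d^*)%C = c & (d^*)%C = d].
Proof.
rewrite /flip_hermitian (flip_starD star_op) flip_star_angular flip_star_const.
by split=> [/addrI/(const_form_inj i0 lam_neq0)|[-> -> -> ->]].
Qed.

End Hermitian.

(** * The classification *)

Section Metrics.
Variables (R : realType) (n : nat) (lam : R[i]) (A : algType R[i]).
Variable F : @function_algebra R n lam A.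

Local Notation t := (fa_t F).
Local Notation r := (fa_r F).
Local Notation tensor := (tensor F).
Local Notation dr := (dr F).
Local Notation v := (v F).
Local Notation angular := (angular F).
Local Notation const_form := (const_form F).
Local Notation rt_form := (rt_form F).

Implicit Types (f h : A) (g : form2 n A).

Hypotheses (i0 : 'I_n.-1) (lam_neq0 : lam != 0) (lam_im : complex.Re lam = 0).

(** The coefficients are put in normal order, t on the right, where symbols and membership in [K]
    can be read off. *)
Lemma const_form_rt a b c d : const_form a b c d =
  rt_form (a%:A - (b + c) *: t + d *: (t * t)) (b *: r - d *: (r * t))
    ((c + lam * d) *: r - d *: (r * t)) (d *: (r * r)).
Proof.
rewrite const_formE [LHS](central_formE F i0 lam_neq0) !mulr_algl t_r.
by rewrite scalerDl opprD addrA scalerBr opprB addrA scalerA -scalerDl (mulrC d).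
Qed.

Lemma eq_angular_const a b c d a' b' c' d' :
  a = a' -> b = b' -> c = c' -> d = d' ->
  angular + const_form a b c d = angular + const_form a' b' c' d'.
Proof. by move=> -> -> -> ->. Qed.

(** The substitution t |-> t + beta turns v into v - beta dr; the new constants come from expanding
    the tensors. *)
Lemma time_translate_const beta a b c d :
  time_translate F beta (const_form a b c d)
    (const_form (a - (b + c) * beta%:C + d * beta%:C ^+ 2)
       (b - d * beta%:C) (c - d * beta%:C) d).
Proof.
rewrite !const_form_rt; apply: time_translate_rt_form => // x s sx;
  by rewrite !(symbD, symbN, symbZ, symb_rl, symb_tr, fa_one, fa_tE, fa_rE) //; ring.
Qed.

Lemma const_form_standard (K : A -> Prop) a b c d : null_mode_free F K ->
  standard_angular_part F K (angular + const_form a b c d).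
Proof.
move=> K_class; rewrite const_form_rt.
set prr := _ + _ *: (t * t); set prt := b *: r - _; set ptr := _ *: r - _.
set ptt := _ *: (r * r); exists prr, prt, ptr, ptt.
have Kt : K t by rewrite -(mul1r t); apply: (nmf_t K_class) (nmf_1 K_class).
have Kr : K r by rewrite -(mulr1 r); apply: (nmf_r K_class) (nmf_1 K_class).
have Krt : K (r * t) by exact: nmf_r K_class _ Kt.
split; last exact/esym/addr_lin4.
- apply: (nmfD K_class); last by apply/(nmfZ K_class)/(nmf_t K_class).
  apply: (nmfD K_class); first exact/(nmfZ K_class)/(nmf_1 K_class).
  exact/(nmfN K_class)/(nmfZ K_class).
- by apply: (nmfD K_class); [exact: (nmfZ K_class)|exact/(nmfN K_class)/(nmfZ K_class)].
- by apply: (nmfD K_class); [exact: (nmfZ K_class)|exact/(nmfN K_class)/(nmfZ K_class)].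
- by apply/(nmfZ K_class)/(nmf_r K_class).
Qed.

Lemma const_form_commutes a b c d : commutes_with_rt F (angular + const_form a b c d).
Proof.
move=> f f_rt.
by rewrite scalerDr form2_mulrD angular_mulr (const_form_mulr i0 lam_neq0 _ _ _ _ f_rt).
Qed.

Section Star.
Variables (star : A -> A) (star_op : star_operation F star).

(** This is a dr (x) dr + c (dr (x) v + v^* (x) dr) + b (v^* (x) v + lam (dr (x) v - v^* (x) dr))
    added to the angular part, rewritten with v^* = v - lam dr. *)
Definition family_metric (a c b : R) : form2 n A :=
  angular + const_form (a%:C - lam * c%:C + lam ^+ 2 * b%:C) c%:C
              (c%:C - lam * b%:C) b%:C.

Lemma std_metricE a b : std_metric F star a b = family_metric a 0 b.
Proof.
have E : tensor (vstar F star) v +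
    (lam%:A : A) *: (tensor dr v - tensor (vstar F star) dr) =
    const_form (lam ^+ 2) 0 (- lam) 1.
  have -> : tensor dr v - tensor (vstar F star) dr = const_form lam 1 (-1) 0.
    rewrite (tensor_vstar_dr lam_neq0 star_op) tensor_drv_const.
    rewrite const_formN const_formD.
    by apply: eq_const_form; ring.
  rewrite (tensor_vstar_v lam_neq0 star_op) const_formZ const_formD.
  by apply: eq_const_form; ring.
rewrite /std_metric /real_const E tensor_drr_const -(addrA angular).
congr (_ + _); rewrite (const_formZ F a%:C) (const_formZ F b%:C) const_formD.
by apply: eq_const_form; ring.
Qed.

Lemma exceptional_metricE a c : exceptional_metric F star a c = family_metric a c 0.
Proof.
have E : tensor dr v + tensor (vstar F star) dr = const_form (- lam) 1 1 0.
  rewrite (tensor_vstar_dr lam_neq0 star_op) tensor_drv_const const_formD.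
  by apply: eq_const_form; ring.
rewrite /exceptional_metric /real_const E tensor_drr_const -(addrA angular).
congr (_ + _); rewrite (const_formZ F a%:C) (const_formZ F c%:C) const_formD.
by apply: eq_const_form; ring.
Qed.

Lemma time_translate_family beta a b :
  time_translate F beta (family_metric (a + b * beta ^+ 2) (b * beta) b)
    (family_metric a 0 b).
Proof.
have -> : family_metric a 0 b = angular + const_form
    ((a + b * beta ^+ 2)%:C - lam * (b * beta)%:C + lam ^+ 2 * b%:C
      - ((b * beta)%:C + ((b * beta)%:C - lam * b%:C)) * beta%:C + b%:C * beta%:C ^+ 2)
    ((b * beta)%:C - b%:C * beta%:C)
    ((b * beta)%:C - lam * b%:C - b%:C * beta%:C) b%:C.
  rewrite /family_metric.
  have C1 : (a + b * beta ^+ 2)%:C = a%:C + b%:C * beta%:C ^+ 2.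
    by rewrite rmorphD rmorphM rmorphXn.
  have C2 : (b * beta)%:C = b%:C * beta%:C by rewrite rmorphM.
  by rewrite C1 C2; apply: eq_angular_const; ring.
by apply: time_translateD; [exact: time_translate_angular|exact: time_translate_const].
Qed.

Lemma conjc_realE (z : R[i]) : (z^*)%C = z -> z = (complex.Re z)%:C.
Proof.
case: z => x y [] /eqP; rewrite -subr_eq0 -opprD oppr_eq0 -mulr2n mulrn_eq0 /=.
by move/eqP ->.
Qed.

Lemma family_metricP a b c d :
  flip_hermitian F star (angular + const_form a b c d) ->
  quantum_symmetric (angular + const_form a b c d) ->
  exists a' c' b' : R, angular + const_form a b c d = family_metric a' c' b'.
Proof.
move=> /(flip_hermitianP i0 lam_neq0 lam_im star_op)[aE bE cE dR].
move=> /(const_form_symmetric F i0 lam_neq0) bcE.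
have lamC := conjc_lam lam_im.
have bR : (b^*)%C = b by rewrite [RHS]bcE -cE dR subrK.
(* While b and d are real, a is not in general: this relation and the sign change of lam under
   conjugation make a + lam b real. Subtracting the real lam^2 d matches the normalization of the
   family. *)
have aS : (a^*)%C = a + lam * b *+ 2.
  have cS : (c^*)%C = b + lam * d by rewrite -bE dR subrK.
  by rewrite -[in RHS]aE cS bR dR; ring.
have aR : ((a + lam * b - lam ^+ 2 * d)^*)%C = a + lam * b - lam ^+ 2 * d.
  by rewrite expr2 !(rmorphB, rmorphD, rmorphM) /= lamC bR dR aS; ring.
exists (complex.Re (a + lam * b - lam ^+ 2 * d)), (complex.Re b), (complex.Re d).
rewrite /family_metric -(conjc_realE aR) -(conjc_realE bR) -(conjc_realE dR).
by apply: eq_angular_const => //; [ring|rewrite bcE; ring].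
Qed.

Lemma family_metric_hermitian a c b : flip_hermitian F star (family_metric a c b).
Proof.
apply/(flip_hermitianP i0 lam_neq0 lam_im star_op).
have lamC := conjc_lam lam_im.
have realC (x : R) : (x%:C^*)%C = x%:C by exact: conjc_real.
move: a%:C c%:C b%:C (realC a) (realC c) (realC b) => x y z xR yR zR.
by rewrite expr2 !(rmorphB, rmorphD, rmorphM) /= lamC xR yR zR; split; ring.
Qed.

Lemma family_metric_symmetric a c b : quantum_symmetric (family_metric a c b).
Proof. by apply/(const_form_symmetric F i0 lam_neq0); ring. Qed.

End Star.
End Metrics.

Theorem proposition2p3 (R : realType) (n : nat) (n_gt1 : (1 < n)%N)
    (lam : R[i]) (lam_imaginary : complex.Re lam = 0) (lam_neq0 : lam != 0)
    (A : algType R[i]) (F : @function_algebra R n lam A)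
    (star : A -> A) (star_op : star_operation F star)
    (K : A -> Prop) (K_class : null_mode_free F K) (g : form2 n A) :
  [/\ standard_angular_part F K g, commutes_with_rt F g,
      flip_hermitian F star g & quantum_symmetric g]
  <->
  (exists beta a b : R, time_translate F beta g (std_metric F star a b)) \/
  (exists a c : R, c != 0 /\ g = exceptional_metric F star a c).
Proof.
have i0 : 'I_n.-1 by exists 0%N; rewrite ltn_predRL.
have familyP a c b : [/\ standard_angular_part F K (family_metric F a c b),
    commutes_with_rt F (family_metric F a c b),
    flip_hermitian F star (family_metric F a c b)
    & quantum_symmetric (family_metric F a c b)].
  split.
  - exact: const_form_standard.
  - exact: const_form_commutes.
  - exact: family_metric_hermitian.
  - exact: family_metric_symmetric.
split=> [[g_std g_comm g_herm g_sym]|[[beta [a [b g_std]]]|[a [c [_ ->]]]]].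
- have [a [b [c [d gE]]]] := commuting_const_form i0 lam_neq0 K_class g_std g_comm.
  move: g_herm g_sym; rewrite gE => g_herm g_sym.
  have [a' [c' [b' gE']]] :=
    family_metricP i0 lam_neq0 lam_imaginary star_op g_herm g_sym.
  rewrite gE'; have [b0|b_neq0] := eqVneq b' 0; last first.
    (* Completing the square: translation by c' / b' cancels the middle parameter and lowers the
       first by b' (c' / b')^2. *)
    left; exists (c' / b'), (a' - b' * (c' / b') ^+ 2), b'.
    rewrite (std_metricE lam_neq0 star_op).
    have := time_translate_family F i0 lam_neq0 (c' / b') (a' - b' * (c' / b') ^+ 2) b'.
    by rewrite subrK (mulrC b') divfK.
  have [c0|c_neq0] := eqVneq c' 0.
    left; exists 0, a', 0; rewrite (std_metricE lam_neq0 star_op) b0 c0.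
    by move=> x y z s sx; rewrite addr0.
  right; exists a', c'; split; first exact: c_neq0.
  rewrite b0.
  exact: esym (exceptional_metricE lam_neq0 star_op a' c').
- suff -> : g = family_metric F (a + b * beta ^+ 2) (b * beta) b by [].
  (* Both forms have the same translate, and a symbol at s is that of the translate at s - beta. *)
  apply: form2_eq => k l; apply: (@fa_inj _ _ _ _ F) => x s sx.
  have tr := time_translate_family F i0 lam_neq0 beta a b.
  rewrite -(std_metricE lam_neq0 star_op) in tr.
  by rewrite -(subrK beta%:C s) -g_std // -tr.
- by rewrite (exceptional_metricE lam_neq0 star_op).
Qed.
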